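(* Let $\mu>-\frac12$ and $\lambda>0$, and for integers $n\ge0$ let $$J_n^{(\lambda;\mu)}=\int_{-1}^1\bigl(C_n^{(\lambda)}(x)\bigr)^2(1-x^2)^{\mu-\frac12}\,dx .$$ Then $$J_n^{(\lambda;\mu)}=\frac{\sqrt\pi\,\Gamma(\mu+\frac12)}{\Gamma(\mu+1)}\left(\frac{(2\lambda)_n}{n!}\right)^2{}_4F_3\!\left(\begin{matrix}-n,\;n+2\lambda,\;\lambda,\;\mu+\frac12\\ 2\lambda,\;\lambda+\frac12,\;\mu+1\end{matrix}\,\middle|\,1\right);$$ alternatively, $$J_n^{(\lambda;\mu)}=\frac{\sqrt\pi\,\Gamma(\mu+\frac12)}{\mu\,\Gamma(\mu+1)}\sum_{k=0}^{\lfloor n/2\rfloor}\frac{(\lambda)_{n-k}^2\,(\lambda-\mu)_k^2}{(\mu+1)_{n-k}^2\,(k!)^2}\,(n+\mu-2k)\,\frac{(2\mu)_{n-2k}}{(n-2k)!}.$$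
   Context: $C_n^{(\lambda)}$ denotes the Gegenbauer polynomial in the standard normalisation $\sum_{n=0}^\infty C_n^{(\lambda)}(x)z^n=(1-2xz+z^2)^{-\lambda}$. The Pochhammer symbol is $(a)_n=a(a+1)\cdots(a+n-1)$, $(a)_0=1$. The hypergeometric function is ${}_pF_q\!\left(\begin{smallmatrix}a_1,\ldots,a_p\\ b_1,\ldots,b_q\end{smallmatrix}\,\middle|\,z\right)=\sum_{k\ge0}\frac{(a_1)_k\cdots(a_p)_k}{(b_1)_k\cdots(b_q)_k\,k!}z^k$; here the series terminates because $-n$ is an upper parameter.
   Formalization: The second formula is undefined (0/0) at μ=0, which the hypothesis μ>-1/2 allows; it is stated literally for μ≠0, and for μ=0 it is stated that its right-hand side tends to J_n^{(λ;0)} as μ→0. *)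

(* Defs.v *)
From HB Require Import structures.
From mathcomp Require Import all_boot all_order all_algebra.
From mathcomp Require Import all_classical all_reals all_analysis.
Set Implicit Arguments.
Unset Strict Implicit.
Unset Printing Implicit Defensive.
Import Order.TTheory GRing.Theory Num.Theory.
Import numFieldNormedType.Exports.
Local Open Scope classical_set_scope.
Local Open Scope ring_scope.

(* Euler's integral; meaningful for 0 < a. *)
Definition Gamma (R : realType) (a : R) : R :=
  (\int[@lebesgue_measure R]_(t in `]0, +oo[) (t `^ (a - 1) * expR (- t)))%R.

Definition pochhammer (R : realType) (a : R) (n : nat) : R :=
  \prod_(i < n) (a + i%:R).

(* [pFq a b z] is the hypergeometric series with upper parameters [a] and lower
   parameters [b]; meaningful when the series converges and no denominator
   vanishes. *)
Definition pFq (R : realType) (a b : seq R) (z : R) : R :=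
  limn (series (fun k : nat =>
    (\prod_(c <- a) pochhammer c k) / ((\prod_(c <- b) pochhammer c k) * k`!%:R)
      * z ^+ k)).

(* The generating function is an identity of power series in [z], so it is
   required only on some neighbourhood of 0, which may depend on [x]; this
   already determines every [C n]. *)
Definition is_gegenbauer (R : realType) (lambda : R) (C : nat -> {poly R}) :=
  forall x : R, \forall z \near (0 : R),
    series (fun n : nat => (C n).[x] * z ^+ n) @ \oo
      --> (1 - 2 * x * z + z ^+ 2) `^ (- lambda).

Definition weighted_norm2 (R : realType) (mu : R) (p : {poly R}) : \bar R :=
  (\int[@lebesgue_measure R]_(x in `[(-1)%R, 1%R])
     (p.[x] ^+ 2 * (1 - x ^+ 2) `^ (mu - 2^-1))%:E)%E.

(* Because of the factor [mu^-1], meaningful only for [mu != 0]; the singularity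
   at [mu = 0] is removable. *)
Definition J_sum (R : realType) (lambda mu : R) (n : nat) : R :=
  Num.sqrt pi * Gamma (mu + 2^-1) / (mu * Gamma (mu + 1)) *
  \sum_(k < n./2.+1)
    (pochhammer lambda (n - k) ^+ 2 * pochhammer (lambda - mu) k ^+ 2)
      / (pochhammer (mu + 1) (n - k) ^+ 2 * k`!%:R ^+ 2)
    * (n%:R + mu - 2 * k%:R)
    * (pochhammer (2 * mu) (n - k.*2) / (n - k.*2)`!%:R).

(* Main.v *)
Require Import Defs.
From mathcomp Require Import all_boot all_order all_algebra.
From mathcomp Require Import all_classical all_reals all_analysis.
From mathcomp Require Import measurable_realfun zify ring lra.
Import Order.TTheory GRing.Theory Num.Theory.
Import numFieldNormedType.Exports.
Local Open Scope classical_set_scope.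
Local Open Scope ring_scope.

(** The generating function [f = w ^ (- lambda)], [w = 1 - 2 * x * z + z ^ 2],
    satisfies [w * f' = 2 * lambda * (x - z) * f]; since a power series that
    vanishes near 0 has zero coefficients, this turns into the three-term
    recurrence, which determines the polynomials ([gegenbauer_coef]).  The
    recurrence yields their second order differential equation ([geg_ode]).

    Write [u = 1 - x ^ 2].  The square of an even or odd polynomial is a
    polynomial in [u], and multiplying the weight by [u ^ k] replaces [mu] by
    [mu + k].  So everything rests on the mass of the weight, which is a Beta
    integral ([betae_Gamma], [weight_mass_add]): up to the total mass, the
    integral of an even polynomial is a linear functional of its coefficients
    in [u] ([moment]).

    First formula.  The square of a solution of a second order linear equation
    solves one of third order ([geg_sqr_ode]).  In the variable [u] this is a
    hypergeometric equation: the coefficients of the square obey a two-term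
    recurrence and are explicit products ([clausen_coef], Clausen's formula).
    Integrating [u ^ k] adds the factors [(mu + 1/2)_k / (mu + 1)_k] and turns
    the resulting 3F2 into the 4F3 at 1.

    Second formula.  For the functional attached to [mu], the polynomials of
    parameter [mu] are orthogonal and have known norms ([geg_orthogonal],
    [geg_norm]).  Those of parameter [lambda] are explicit combinations of them
    ([geg_connection_down]), and the sum is Parseval's identity
    ([moment_geg_sqr]).  Here [mu] has to be nonzero.  At [mu = 0] the sum is,
    for all small [m <> 0], the integral with the weight of parameter [m], and
    this integral is continuous in [m] ([cvg_weight_mass_moment0]). *)

(** * Integrals over the line *)

Section affine.
Context {R : realType}.
Local Notation leb := (@lebesgue_measure R).
Variables (c d : R).
Hypothesis c0 : 0 < c.

Let phi (x : measurableTypeR R) : measurableTypeR R := c * x + d.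

Let mphi : measurable_fun setT phi.
Proof.
apply: (@measurable_funD _ _ R setT (fun x => c * x) (cst d)) => //.
exact: mulrl_measurable.
Qed.

Let nu : {measure set (measurableTypeR R) -> \bar R} :=
  measure_function_pushforward__canonical__measure_function_Measure leb mphi.

Let cnn : {nonneg R} := NngNum (ltW c0).

(* Both measures give the interval ]a, b] the mass [b - a], and a measure on the
   line is determined by these masses. *)
Let affine_measureE (A : set (measurableTypeR R)) : measurable A ->
  leb A = mscale cnn nu A.
Proof.
apply: lebesgue_measure_unique => _ [[a b]] _ <- /=.
rewrite /mscale /nu /= /pushforward.
rewrite (_ : phi @^-1` `]a, b] = `](a - d) / c, (b - d) / c]%classic); last first.
  apply/seteqP; split=> x /=; rewrite !in_itv /= /phi.
    by rewrite ltr_pdivrMr// ler_pdivlMr// ltrBlDr lerBrDr mulrC.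
  by rewrite ltr_pdivrMr// ler_pdivlMr// ltrBlDr lerBrDr mulrC.
rewrite !lebesgue_measure_itv /= !lte_fin ltr_pM2r ?invr_gt0// ltrD2r.
case: ifPn => ab; last by rewrite mule0.
rewrite -!EFinB -EFinM -mulrBl opprB addrA subrK mulrC divfK ?gt_eqF//.
Qed.

Lemma ge0_integral_affine (f : R -> \bar R) : measurable_fun setT f ->
  (forall x, 0 <= f x)%E ->
  (\int[leb]_x f x = c%:E * \int[leb]_x f (c * x + d)%R)%E.
Proof.
move=> mf f0.
rewrite (@eq_measure_integral _ _ _ _ (mscale cnn nu));
  last by move=> A mA _; exact: affine_measureE.
rewrite ge0_integral_mscale//; congr (_ * _)%E.
by rewrite (ge0_integral_pushforward mphi).
Qed.

End affine.

(** The integrand of Euler's integrals, extended by zero to the whole line: all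
    changes of variables then take place on the line itself. *)
Definition pospow {R : realType} (b s : R) : R :=
  if 0 < s then s `^ (b - 1) else 0.

Section pospow.
Context {R : realType}.
Local Notation leb := (@lebesgue_measure R).
Implicit Types a b s t : R.

Lemma pospow_ge0 b s : 0 <= pospow b s.
Proof. by rewrite /pospow; case: ifP => // _; exact: powR_ge0. Qed.

Lemma measurable_pospow b : measurable_fun [set: R] (pospow b).
Proof.
rewrite /pospow; apply: measurable_fun_ifT => //.
by apply: measurable_fun_ltr.
Qed.

Lemma measurable_pospow_comp b d (T : measurableType d) (f : T -> R) :
  measurable_fun setT f -> measurable_fun setT (fun x => pospow b (f x)).
Proof. by move=> mf; apply: (measurableT_comp (@measurable_pospow b)). Qed.

Lemma measurable_expRN : measurable_fun [set: R] (fun t => expR (- t)).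
Proof. by apply: measurableT_comp => //; apply: oppr_measurable. Qed.

(** The integrand may blow up at 0, where the fundamental theorem of calculus
    does not apply; the interval is exhausted by the [[t / (n + 2), t]]. *)
Lemma integral_pospow_lt a t : 0 < a ->
  (\int[leb]_s (if s < t then pospow a s else 0)%:E = (pospow (a + 1) t / a)%:E)%E.
Proof.
move=> a0.
rewrite {2}/pospow addrK; case: ifPn => t0; last first.
  rewrite mul0r integral0_eq// => s _.
  by rewrite /pospow; case: ltP => // st; case: ltP => // s0; case/negP: t0; lra.
pose F (n : nat) := [set` `[t / n.+2%:R, t]].
have F0 n : 0 < t / n.+2%:R by rewrite divr_gt0.
have Ft n : t / n.+2%:R < t by rewrite ltr_pdivrMr// ltr_pMr// ltr1n.
have UF : \bigcup_n F n = `]0, t]%classic.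
  apply/seteqP; split=> [x [n _]|x]; rewrite /F /= !in_itv /=.
    by move=> /andP[Fx ->]; rewrite (lt_le_trans (F0 n) Fx).
  move=> /andP[x0 xt]; have [n nx] := ltr_add_invr (divr_gt0 x0 t0).
  exists n => //; rewrite /F /= in_itv /= xt andbT.
  rewrite add0r in nx; have : n.+2%:R^-1 < x / t.
    by apply: le_lt_trans nx; rewrite lef_pV2 ?posrE// ler_nat.
  by move/ltW; rewrite ler_pdivlMr// mulrC.
pose f s : \bar R := (if s < t then pospow a s else 0)%:E.
have mf : measurable_fun setT f.
  apply/measurable_EFinP; apply: measurable_fun_ifT => //.
    by apply: measurable_fun_ltr.
  exact: measurable_pospow.
have f0 s : (0 <= f s)%E.
  by rewrite /f lee_fin; case: ifP => // _; exact: pospow_ge0.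
have -> : (\int[leb]_s f s = \int[leb]_(s in \bigcup_n F n) f s)%E.
  rewrite UF [RHS]integral_mkcond; apply: eq_integral => s _.
  rewrite patchE; case: ifPn => //; rewrite notin_setE /= in_itv /=.
  move=> /negP; rewrite negb_and -leNgt -ltNge /f /pospow.
  by case/orP=> ?; case: ltP => // st; case: ltP => // s0; exfalso; lra.
have /cvg_lim <- // : (\int[leb]_(s in F i) f s @[i --> \oo] -->
    \int[leb]_(s in \bigcup_n F n) f s)%E.
  apply: ge0_nondecreasing_set_cvg_integral.
  - move=> m n mn; apply/subsetPset => x; rewrite /F /= !in_itv /= => /andP[+ ->].
    by rewrite andbT; apply: le_trans; rewrite ler_pM2l// lef_pV2 ?posrE// ler_nat.
  - by move=> n; exact: measurable_itv.
  - by move=> n; apply: measurable_funTS.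
  - by move=> *; exact: f0.
apply/cvg_lim => //.
have FE n : (\int[leb]_(s in F n) f s = ((t `^ a - (t / n.+2%:R) `^ a) / a)%:E)%E.
  have -> : (\int[leb]_(s in F n) f s = \int[leb]_(s in F n) (s `^ (a - 1))%:E)%E.
    rewrite /F /= [LHS]integral_itv_bndoo; last exact: measurable_funTS.
    rewrite [RHS]integral_itv_bndoo; last first.
      by apply/measurable_EFinP; apply: measurable_funTS.
    apply: eq_integral => s; rewrite inE /= in_itv /= => /andP[s0 st].
    by rewrite /f /pospow st (lt_trans (F0 n)).
  rewrite (@continuous_FTC2 _ _ (fun s => s `^ a / a)) //.
  + by rewrite mulrBl EFinB.
  + apply: continuous_in_subspaceT => s; rewrite inE /= in_itv /= => /andP[s0 _].
    apply/differentiable_continuous/derivable1_diffP.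
    by apply: ex_derive; apply: is_derive1_powR; rewrite (lt_le_trans (F0 n)).
  + have cc x : 0 < x -> {for x, continuous (fun s => s `^ a / a)}.
      move=> x0; apply/differentiable_continuous/derivable1_diffP.
      apply: derivableM => //.
      by apply: ex_derive; apply: is_derive1_powR.
    split.
    * move=> x; rewrite in_itv /= => /andP[x0 _]; apply: derivableM => //.
      by apply: ex_derive; apply: is_derive1_powR; rewrite (lt_trans (F0 n)).
    * by apply: cvg_at_right_filter; apply: cc.
    * by apply: cvg_at_left_filter; apply: cc.
  + move=> x; rewrite in_itv /= => /andP[x0 _].
    have xp : 0 < x by rewrite (lt_trans (F0 n)).
    rewrite derive1E deriveMr; last by apply: ex_derive; apply: is_derive1_powR.
    have [_ ->] := is_derive1_powR a xp.
    by rewrite mulrC mulrAC divff ?mul1r// gt_eqF.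
rewrite (_ : (fun i => _) = EFin \o (fun n => (t `^ a - (t / n.+2%:R) `^ a) / a));
  last by apply/funext => n /=; rewrite FE.
apply: cvg_EFin; first exact: nearW.
rewrite /comp /= -{2}[t `^ a]subr0; apply: cvgMl; apply: cvgB; first exact: cvg_cst.
have /cvg_at_rightP := powR_cvg0 a0; apply; split=> [n|]; first exact: F0.
rewrite -[X in _ --> X](mulr0 t); apply: cvgMr.
by have := @cvg_harmonic R; rewrite -cvg_shiftS.
Qed.

End pospow.

(** * Euler's integrals *)

Section gamma.
Context {R : realType}.
Local Notation leb := (@lebesgue_measure R).
Implicit Types a b s t : R.

Lemma integral_expRN_gt s :
  (\int[leb]_t (if s < t then expR (- t) else 0)%:E = (expR (- s))%:E)%E.
Proof.
have cE x : {for x, continuous (fun t : R => expR (- t))}.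
  by apply: continuous_comp; [exact: opp_continuous | exact: continuous_expR].
transitivity (\int[leb]_(t in `[s, +oo[) (expR (- t))%:E)%E.
  rewrite -integral_itv_obnd_cbnd; last first.
    by apply/measurable_EFinP; apply: measurable_funTS; exact: measurable_expRN.
  rewrite [RHS]integral_mkcond; apply: eq_integral => t _.
  rewrite patchE; case: ifPn => st; case: ifPn => //.
    by rewrite notin_setE /= in_itv /= st.
  by rewrite inE /= in_itv /= andbT (negbTE st).
rewrite (@ge0_continuous_FTC2y _ _ (fun t => - expR (- t)) _ 0).
- by rewrite sub0e EFinN oppeK.
- by move=> x _; exact: expR_ge0.
- apply: continuous_in_subspaceT => x _; exact: cE.
- rewrite -oppr0; apply: cvgN; exact: cvgr_expR.
- by move=> x _; exact: ex_derive.
- by apply: cvg_at_right_filter; apply: cvgN; apply: cE.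
- move=> x _; rewrite derive1E.
  have h : is_derive x 1 (fun t => - expR (- t)) (- (expR (- x) * (-1))).
    by apply: is_derive_eq; rewrite /GRing.scale /=; ring.
  by rewrite derive_val mulrN1 opprK.
Qed.

(** Euler's integral with values in the extended reals, so that it can be
    handled before it is known to converge. *)
Definition gammae a : \bar R := (\int[leb]_t (pospow a t * expR (- t))%:E)%E.

Lemma measurable_gamma_fun a :
  measurable_fun [set: R] (fun t => (pospow a t * expR (- t))%:E).
Proof.
apply/measurable_EFinP; apply: measurable_funM => //.
  exact: measurable_pospow.
exact: measurable_expRN.
Qed.

Lemma gamma_fun_ge0 a t : (0 <= (pospow a t * expR (- t))%:E)%E.
Proof. by rewrite lee_fin mulr_ge0 ?pospow_ge0 ?expR_ge0. Qed.

Lemma GammaE a : Gamma a = fine (gammae a).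
Proof.
rewrite /Gamma /Rintegral integral_mkcond; congr fine.
apply: eq_integral => t _; rewrite patchE /pospow; case: ifPn.
  by rewrite inE /= in_itv /= andbT => ->.
by rewrite notin_setE /= in_itv /= andbT => /negP/negbTE ->; rewrite mul0r.
Qed.

Lemma measurable_if_ltr d (T : measurableType d) (f g h : T -> R) :
  measurable_fun setT f -> measurable_fun setT g -> measurable_fun setT h ->
  measurable_fun setT (fun x => if f x < g x then h x else 0).
Proof.
by move=> mf mg mh; apply: measurable_fun_ifT => //; apply: measurable_fun_ltr.
Qed.

(** Integration by parts in the form of an exchange: both sides are the integral
    of [a * s ^ (a - 1) * exp (- t)] over [0 < s < t]. *)
Lemma gammaeS a : 0 < a -> gammae (a + 1) = (a%:E * gammae a)%E.
Proof.
move=> a0.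
pose f (z : R * R) : \bar R :=
  ((if z.1 < z.2 then pospow a z.1 else 0) * expR (- z.2))%:E.
have mf : measurable_fun setT f.
  apply/measurable_EFinP; apply: measurable_funM.
    by apply: measurable_if_ltr => //; apply: measurable_pospow_comp.
  by apply: (measurableT_comp measurable_expRN).
have f0 z : (0 <= f z)%E.
  rewrite lee_fin mulr_ge0 ?expR_ge0//; case: ifP => // _; exact: pospow_ge0.
have := fubini_tonelli (m1 := leb) (m2 := leb) f mf f0.
have -> : (\int[leb]_s \int[leb]_t f (s, t) = gammae a)%E.
  apply: eq_integral => s _.
  rewrite EFinM -integral_expRN_gt -ge0_integralZl//.
  - by apply: eq_integral => t _; rewrite /f /= -EFinM; case: ifP; rewrite ?mul0r ?mulr0.
  - apply/measurable_EFinP; apply: measurable_if_ltr => //; exact: measurable_expRN.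
  - by move=> t _; case: ifP => // _; rewrite lee_fin expR_ge0.
  - by rewrite lee_fin pospow_ge0.
move=> ->.
rewrite -ge0_integralZl//; last by rewrite lee_fin ltW.
- apply: eq_integral => t _; rewrite /f /=.
  have -> : (\int[leb]_s ((if s < t then pospow a s else 0) * expR (- t))%:E =
      \int[leb]_s ((if s < t then pospow a s else 0)%:E * (expR (- t))%:E))%E by [].
  rewrite ge0_integralZr//.
  + by rewrite integral_pospow_lt// -!EFinM; congr EFin; field; rewrite gt_eqF.
  + by apply/measurable_EFinP; apply: measurable_if_ltr => //; exact: measurable_pospow.
  + by move=> s _; case: ifP => // _; rewrite lee_fin pospow_ge0.
- exact: measurable_fun_fubini_tonelli_G.
- by move=> t _; apply: integral_ge0 => s _; exact: f0.
Qed.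

(** For [a <= 1] the integrand is at most its power factor below 2, and at most
    its exponential factor above 1; the functional equation does the rest. *)
Lemma gammae_fin_num a : 0 < a -> gammae a \is a fin_num.
Proof.
move=> a0; rewrite ge0_fin_numE; last by apply: integral_ge0 => t _; exact: gamma_fun_ge0.
have [n an] : exists n : nat, a <= n.+1%:R.
  by exists (Num.bound a); rewrite (le_trans (ltW (archi_boundP (ltW a0))))// ler_nat.
elim: n a a0 an => [a a0 |n IHn a a0 an].
  rewrite -[1%:R]/(1 : R) => a1.
  pose g t : \bar R := (if t < 2 then pospow a t else 0)%:E.
  pose h t : \bar R := (if 1 < t then expR (- t) else 0)%:E.
  have mg : measurable_fun setT g.
    by apply/measurable_EFinP; apply: measurable_if_ltr => //; exact: measurable_pospow.
  have mh : measurable_fun setT h.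
    by apply/measurable_EFinP; apply: measurable_if_ltr => //; exact: measurable_expRN.
  have g0 t : (0 <= g t)%E by rewrite /g; case: ifP => // _; rewrite lee_fin pospow_ge0.
  have h0 t : (0 <= h t)%E by rewrite /h; case: ifP => // _; rewrite lee_fin expR_ge0.
  apply: (@le_lt_trans _ _ (\int[leb]_t (g t + h t))%E).
    apply: ge0_le_integral => //.
    - by move=> t _; exact: gamma_fun_ge0.
    - exact: measurable_gamma_fun.
    - exact: emeasurable_funD.
    move=> t _; rewrite /g /h -EFinD lee_fin /pospow.
    have e0 := expR_ge0 (- t); have p0 := powR_ge0 t (a - 1).
    case: (ltP 0 t) => t0; last by rewrite mul0r; do 2!case: ifP; rewrite ?addr0.
    have e1 : expR (- t) <= 1 by rewrite expR_le1; lra.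
    case: (ltP 1 t) => t1.
      have : t `^ (a - 1) <= 1 by rewrite -[leRHS](powRr0 t) ler_powR; lra.
      by case: ifP => _; nra.
    have -> : t < 2 by lra.
    by nra.
  rewrite ge0_integralD// integral_expRN_gt integral_pospow_lt//.
  by rewrite -EFinD ltry.
have [a1|a1] := lerP a 1.
  by apply: IHn => //; rewrite (le_trans a1)// ler1n.
have -> : a = a - 1 + 1 by ring.
rewrite gammaeS; last by lra.
have : gammae (a - 1) \is a fin_num.
  rewrite ge0_fin_numE; last by apply: integral_ge0 => t _; exact: gamma_fun_ge0.
  by apply: IHn; [lra | move: an; rewrite (natrD _ 1 n.+1)/=; lra].
by move/fineK <-; rewrite -EFinM ltry.
Qed.

Lemma gammae_Gamma a : 0 < a -> gammae a = (Gamma a)%:E.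
Proof. by move=> a0; rewrite GammaE fineK// gammae_fin_num. Qed.

Lemma GammaS a : 0 < a -> Gamma (a + 1) = a * Gamma a.
Proof.
by move=> a0; apply: EFin_inj; rewrite EFinM -!gammae_Gamma ?gammaeS// addr_gt0.
Qed.

Lemma Gamma_gt0 a : 0 < a -> 0 < Gamma a.
Proof.
move=> a0; rewrite -lte_fin -gammae_Gamma//.
apply: (@lt_le_trans _ _ (a^-1 * expR (- 1))%:E).
  by rewrite lte_fin mulr_gt0 ?invr_gt0 ?expR_gt0.
have -> : a^-1 = pospow (a + 1) 1 / a.
  by rewrite /pospow ltr01 powR1 mul1r.
rewrite EFinM -integral_pospow_lt// -ge0_integralZr//.
- apply: ge0_le_integral => //.
  + move=> t _; rewrite -EFinM lee_fin mulr_ge0 ?expR_ge0//.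
    by case: ifP => // _; exact: pospow_ge0.
  + apply/measurable_EFinP; apply: measurable_funM => //.
    by apply: measurable_if_ltr => //; exact: measurable_pospow.
  + exact: measurable_gamma_fun.
  + move=> t _; rewrite -EFinM lee_fin; case: ifP => t1.
      by rewrite ler_wpM2l ?pospow_ge0// ler_expR; lra.
    by rewrite mul0r mulr_ge0 ?pospow_ge0 ?expR_ge0.
- by apply/measurable_EFinP; apply: measurable_if_ltr => //; exact: measurable_pospow.
- by move=> t _; case: ifP => // _; rewrite lee_fin pospow_ge0.
Qed.

Definition betae b : \bar R := (\int[leb]_x (pospow b (1 - x ^+ 2))%:E)%E.

Lemma measurable_beta_fun b :
  measurable_fun [set: R] (fun x => (pospow b (1 - x ^+ 2))%:E).
Proof.
apply/measurable_EFinP; apply: measurable_pospow_comp.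
by apply: measurable_funB => //; exact: measurable_funX.
Qed.

Lemma pospowM b s t : 0 < s -> pospow b (s * t) = s `^ (b - 1) * pospow b t.
Proof.
move=> s0; rewrite /pospow pmulr_rgt0//.
by case: ifP => t0; rewrite ?mulr0// powRM// ltW.
Qed.

(** The Gaussian integral turns the product into the double integral of
    [t ^ (b - 1) * exp (- t) * exp (- y ^ 2)]; the substitutions [t = s - y ^ 2]
    and then [y = sqrt s * x] separate the variables [s] and [x]. *)
Lemma gammae_betae b : 0 < b ->
  (gammae b * (Num.sqrt pi)%:E = gammae (b + 2^-1) * betae b)%E.
Proof.
move=> b0.
pose f (z : R * R) : \bar R := (pospow b (z.2 - z.1 ^+ 2) * expR (- z.2))%:E.
have mf : measurable_fun setT f.
  apply/measurable_EFinP; apply: measurable_funM.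
    apply: measurable_pospow_comp; apply: measurable_funB => //.
    exact: measurable_funX.
  by apply: (measurableT_comp measurable_expRN).
have f0 z : (0 <= f z)%E by rewrite lee_fin mulr_ge0 ?expR_ge0 ?pospow_ge0.
have := fubini_tonelli (m1 := leb) (m2 := leb) f mf f0.
have -> : (\int[leb]_y \int[leb]_s f (y, s) = gammae b * (Num.sqrt pi)%:E)%E.
  rewrite -integralT_gauss -ge0_integralZl//.
  - apply: eq_integral => y _.
    rewrite -ge0_integralZr//.
    + rewrite [RHS](@ge0_integral_affine _ 1 (- y ^+ 2))//.
      * rewrite mul1e; apply: eq_integral => s _; rewrite /f /= -EFinM; congr EFin.
        by rewrite mul1r -mulrA /gauss_fun -expRD; congr (_ * expR _); ring.
      * apply: emeasurable_funM => //; exact: measurable_gamma_fun.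
      * by move=> t; rewrite mule_ge0 ?gamma_fun_ge0// lee_fin gauss_fun_ge0.
    + exact: measurable_gamma_fun.
    + by move=> t _; exact: gamma_fun_ge0.
    + by rewrite lee_fin gauss_fun_ge0.
  - by apply/measurable_EFinP; exact: measurable_gauss_fun.
  - by move=> y _; rewrite lee_fin gauss_fun_ge0.
  - by apply: integral_ge0 => t _; exact: gamma_fun_ge0.
move=> ->; rewrite -ge0_integralZr//.
- apply: eq_integral => s _; rewrite /f /=.
  have [s0|s0] := ltP 0 s; last first.
    rewrite integral0_eq; last first.
      move=> y _; rewrite /pospow ltNge subr_le0.
      by rewrite (le_trans s0 (sqr_ge0 y)) mul0r.
    by rewrite /pospow ltNge s0 mul0r mul0e.
  have r0 : 0 < Num.sqrt s by rewrite sqrtr_gt0.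
  rewrite (@ge0_integral_affine _ (Num.sqrt s) 0)//.
  + rewrite [in RHS]/pospow s0.
    have -> : s `^ (b + 2^-1 - 1) = Num.sqrt s * s `^ (b - 1).
      rewrite -powR12_sqrt ?ltW// -powRD; last by rewrite (gt_eqF s0) implybT.
      by congr powR; ring.
    rewrite -mulrA EFinM -muleA; congr (_ * _)%E.
    rewrite -ge0_integralZl//.
    * apply: eq_integral => x _; rewrite -EFinM; congr EFin.
      rewrite addr0 exprMn sqr_sqrtr ?ltW// mulrAC -pospowM//; congr (pospow _ _ * _); ring.
    * exact: measurable_beta_fun.
    * by move=> x _; rewrite lee_fin pospow_ge0.
    * by rewrite lee_fin mulr_ge0 ?powR_ge0 ?expR_ge0.
  + apply/measurable_EFinP; apply: measurable_funM => //.
    apply: measurable_pospow_comp; apply: measurable_funB => //.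
  + by move=> x; rewrite lee_fin mulr_ge0 ?expR_ge0 ?pospow_ge0.
- exact: measurable_gamma_fun.
- by move=> t _; exact: gamma_fun_ge0.
- by apply: integral_ge0 => x _; rewrite lee_fin pospow_ge0.
Qed.

Lemma betae_Gamma b : 0 < b ->
  betae b = (Num.sqrt pi * Gamma b / Gamma (b + 2^-1))%:E.
Proof.
move=> b0; have h0 : 0 < b + 2^-1 by rewrite addr_gt0 ?invr_gt0.
have := @gammae_betae b b0; rewrite !gammae_Gamma// -EFinM.
have G0 := Gamma_gt0 _ h0.
move=> h; have : ((Gamma (b + 2^-1))^-1%:E * (Gamma (b + 2^-1))%:E * betae b =
    (Num.sqrt pi * Gamma b / Gamma (b + 2^-1))%:E)%E.
  by rewrite -muleA -h -EFinM; congr EFin; ring.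
by rewrite -EFinM mulVf ?gt_eqF// mul1e.
Qed.

End gamma.

(** * The weight [(1 - x ^ 2) ^ (mu - 1 / 2)] *)

Section weight.
Context {R : realType}.
Local Notation leb := (@lebesgue_measure R).
Local Notation D := (`](-1)%R, 1%R[%classic : set R).
Implicit Types mu p q u : R.

Definition weight_mass mu : R :=
  Num.sqrt pi * Gamma (mu + 2^-1) / Gamma (mu + 1).

Lemma subr1_sqr_gt0 (x : R) : (0 < 1 - x ^+ 2) = (-1 < x < 1).
Proof.
rewrite (_ : 1 - x ^+ 2 = (1 - x) * (1 + x)); last by ring.
apply/idP/andP => [h|[h1 h2]]; last by rewrite mulr_gt0//; lra.
by split; nra.
Qed.

Lemma integral_weight_powR mu : - 2^-1 < mu ->
  (\int[leb]_(x in D) ((1 - x ^+ 2) `^ (mu - 2^-1))%:E)%E = (weight_mass mu)%:E.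
Proof.
move=> hmu; have b0 : 0 < mu + 2^-1 by lra.
have := betae_Gamma _ b0; rewrite (_ : mu + 2^-1 + 2^-1 = mu + 1) /weight_mass => [<-|]; last by field.
rewrite integral_mkcond; apply: eq_integral => x _.
rewrite patchE /pospow mem_setE in_itv /= -subr1_sqr_gt0; case: ifP => // _.
by congr (_ `^ _)%:E; field.
Qed.

Lemma measurable_weight p : measurable_fun [set: R] (fun x => (1 - x ^+ 2) `^ p).
Proof.
apply: (@measurableT_comp _ _ _ _ _ _ (fun y : R => y `^ p)) => //.
by apply: measurable_funB => //; exact: measurable_funX.
Qed.

Lemma weight_massS mu : - 2^-1 < mu ->
  weight_mass (mu + 1) = (mu + 2^-1) / (mu + 1) * weight_mass mu.
Proof.
move=> hmu; have h1 : 0 < mu + 2^-1 by lra.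
have h2 : 0 < mu + 1 by lra.
rewrite /weight_mass [mu + 1 + 2^-1]addrAC (GammaS _ h1) (GammaS _ h2).
by field; rewrite (gt_eqF (Gamma_gt0 _ h2)) (gt_eqF h2).
Qed.

Lemma pochhammerS (a : R) n : pochhammer a n.+1 = pochhammer a n * (a + n%:R).
Proof. by rewrite /pochhammer big_ord_recr. Qed.

Lemma pochhammer0 (a : R) : pochhammer a 0 = 1.
Proof. by rewrite /pochhammer big_ord0. Qed.

Lemma pochhammer_gt0 (a : R) n : 0 < a -> 0 < pochhammer a n.
Proof. by move=> a0; apply: prodr_gt0 => i _; rewrite ltr_wpDr. Qed.

Lemma weight_mass_add mu k : - 2^-1 < mu ->
  weight_mass (mu + k%:R) =
  pochhammer (mu + 2^-1) k / pochhammer (mu + 1) k * weight_mass mu.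
Proof.
move=> hmu; elim: k => [|k IHk]; first by rewrite addr0 !pochhammer0 divr1 mul1r.
have k0 : 0 <= k%:R :> R by [].
rewrite -natr1 addrA weight_massS ?IHk; last by lra.
have P : 0 < pochhammer (mu + 1) k by apply: pochhammer_gt0; lra.
rewrite !pochhammerS; field; rewrite (gt_eqF P) /= andbT !gt_eqF//; lra.
Qed.

(** Multiplying the weight by [(1 - x ^ 2) ^ k] raises its parameter by [k]. *)
Lemma integral_weight_poly mu (W : {poly R}) : - 2^-1 < mu ->
  (\int[leb]_(x in `[(-1)%R, 1%R])
     (W.[1 - x ^+ 2] * (1 - x ^+ 2) `^ (mu - 2^-1))%:E)%E =
  (weight_mass mu * \sum_(k < size W)
     W`_k * (pochhammer (mu + 2^-1) k / pochhammer (mu + 1) k))%:E.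
Proof.
move=> hmu.
have mD : measurable D by exact: measurable_itv.
pose g (k : nat) (x : R) : \bar R := ((W`_k)%:E * ((1 - x ^+ 2) `^ (mu + k%:R - 2^-1))%:E)%E.
have hk (k : nat) : - 2^-1 < mu + k%:R by rewrite ltr_wpDr.
have gI k : leb.-integrable D (fun x : R => ((1 - x ^+ 2) `^ (mu + k%:R - 2^-1))%:E).
  apply/integrableP; split.
    by apply/measurable_EFinP; apply: measurable_funTS; exact: measurable_weight.
  rewrite [ltLHS](_ : _ = (weight_mass (mu + k%:R))%:E) ?ltry//.
  rewrite -integral_weight_powR//; apply: eq_integral => x _.
  by rewrite gee0_abs// lee_fin powR_ge0.
rewrite integral_itv_bndoo; last first.
  apply/measurable_EFinP; apply: measurable_funTS; apply: measurable_funM.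
    apply: (@continuous_measurable_fun R (fun x => W.[1 - x ^+ 2])) => x.
    apply: (@continuous_comp _ _ _ (fun x : R => 1 - x ^+ 2) (horner W)).
      by apply: cvgB; [exact: cvg_cst | apply: cvgM; exact: cvg_id].
    exact: continuous_horner.
  exact: measurable_weight.
transitivity (\int[leb]_(x in D) (\sum_(k < size W) g k x))%E.
  apply: eq_integral => x; rewrite inE /= in_itv /= -subr1_sqr_gt0 => u0.
  rewrite horner_coef mulr_suml -sumEFin; apply: eq_bigr => k _.
  rewrite /g -EFinM -mulrA -(powR_mulrn k (ltW u0)) -powRD; last by rewrite (gt_eqF u0) implybT.
  by congr (_ * powR _ _)%:E; ring.
rewrite integral_sum//; last by move=> k; apply: integrableZl.
rewrite mulr_sumr -sumEFin; apply: eq_bigr => k _.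
rewrite integralZl// integral_weight_powR// weight_mass_add// -EFinM.
by congr EFin; ring.
Qed.

(** The derivative with respect to the exponent is bounded by
    [- u * ln u <= 1 - u]. *)
Lemma powR_lip u p q : 0 < u -> u <= 1 -> 1 <= p -> p <= q ->
  u `^ p <= u `^ q + (q - p).
Proof.
move=> u0 u1 p1 pq.
have -> : q = p + (q - p) by ring.
rewrite powRD; last by rewrite (gt_eqF u0) implybT.
have -> : p + (q - p) - p = q - p by ring.
have up : u `^ p <= u by apply: ge1r_powR => //; rewrite u0.
have up0 := powR_ge0 u p.
have hq : 1 + (q - p) * ln u <= u `^ (q - p).
  by rewrite /powR (gt_eqF u0); exact: expR_ge1Dx.
have hu : 1 - ln u <= u^-1.
  by have := expR_ge1Dx (- ln u); rewrite expRN lnK.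
have {}hu : u - u * ln u <= 1.
  by rewrite -(@mulfV _ u) ?gt_eqF// -[X in X - _]mulr1 -mulrBr ler_pM2l.
have l0 : ln u <= 0 by rewrite ln_le0.
have d0 : 0 <= q - p by rewrite subr_ge0.
have k1 : 0 <= u `^ p * (u `^ (q - p) - (1 + (q - p) * ln u)).
  by rewrite mulr_ge0// subr_ge0.
have k2 : 0 <= (u - u `^ p) * ((q - p) * - ln u).
  by rewrite mulr_ge0 ?subr_ge0// mulr_ge0// oppr_ge0.
have k3 : 0 <= (q - p) * (1 - (u - u * ln u)) by rewrite mulr_ge0// subr_ge0.
have k4 : 0 <= (q - p) * u by rewrite mulr_ge0// ltW.
rewrite -subr_ge0; apply: le_trans (addr_ge0 (addr_ge0 k1 k2) (addr_ge0 k3 k4)) _.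
by rewrite le_eqVlt; apply/orP; left; apply/eqP; ring.
Qed.

Lemma weight_mass_lip p q : 3 / 2 <= p -> 3 / 2 <= q ->
  `|weight_mass p - weight_mass q| <= 2 * `|p - q|.
Proof.
wlog pq : p q / p <= q => [H hp hq|hp hq].
  have [pq|/ltW qp] := leP p q; first exact: H.
  by rewrite distrC [`|p - q|]distrC; exact: H.
have mD : measurable D by exact: measurable_itv.
have mw r : measurable_fun D (fun x : R => ((1 - x ^+ 2) `^ r)%:E).
  by apply/measurable_EFinP; apply: measurable_funTS; exact: measurable_weight.
have uu x : D x -> 0 < 1 - x ^+ 2 <= 1.
  by rewrite /= in_itv /= -subr1_sqr_gt0 => ->; rewrite gerBl sqr_ge0.
have h1 : weight_mass q <= weight_mass p.
  rewrite -lee_fin -!integral_weight_powR; [|lra..].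
  apply: ge0_le_integral => //;
    [by move=> x _; rewrite lee_fin powR_ge0|exact: mw|exact: mw|].
  by move=> x /uu u; rewrite lee_fin ger_powR//; lra.
have h2 : weight_mass p <= weight_mass q + 2 * (q - p).
  rewrite -lee_fin EFinD -!integral_weight_powR; [|lra..].
  have -> : ((2 * (q - p))%:E = \int[leb]_(x in D) (q - p)%:E)%E.
    have D2 : leb D = 2%:E.
      rewrite lebesgue_measure_itv /= lte_fin ifT; last by lra.
      by rewrite -EFinB; congr EFin; ring.
    transitivity ((q - p)%:E * leb D)%E; first by rewrite D2 -EFinM mulrC.
    by rewrite integral_cst.
  rewrite -ge0_integralD//; last 3 first.
  - by move=> x _; rewrite lee_fin powR_ge0.
  - exact: mw.
  - by move=> x _; rewrite lee_fin subr_ge0.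
  apply: ge0_le_integral => //.
  - by move=> x _; rewrite lee_fin powR_ge0.
  - exact: mw.
  - by apply: emeasurable_funD => //; exact: mw.
  - move=> x /uu /andP[u0 u1]; rewrite -EFinD lee_fin.
    have -> : q - p = q - 2^-1 - (p - 2^-1) by ring.
    by apply: powR_lip => //; lra.
rewrite ger0_norm ?subr_ge0// distrC ger0_norm ?subr_ge0//; lra.
Qed.

(** Near 0 the weight is unbounded; raising the exponent by 2, where the mass
    is Lipschitz, costs a rational factor only. *)
Lemma cvg_weight_mass0 : weight_mass m @[m --> (0 : R)] --> weight_mass 0.
Proof.
pose r m : R := (m + 1) / (m + 2^-1) * ((m + 2) / (m + 1 + 2^-1)).
have E m : - 2^-1 < m -> weight_mass m = r m * weight_mass (m + 2).
  move=> hm; have -> : m + 2 = m + 1 + 1 by ring.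
  rewrite !weight_massS /r; [|lra..].
  by field; rewrite !gt_eqF//; lra.
rewrite E ?oppr_lt0//.
apply: (@cvg_trans _ (r m * weight_mass (m + 2) @[m --> (0 : R)])).
  apply: near_eq_cvg; near=> m; rewrite (E m)//.
  by near: m; apply: lt_nbhsr; rewrite oppr_lt0.
have lin c : m + c @[m --> (0 : R)] --> (0 : R) + c.
  by apply: cvgD; [exact: cvg_id | exact: cvg_cst].
have quo c d : d != 0 -> (m + c) / (m + d) @[m --> (0 : R)] --> (0 + c) / (0 + d).
  by move=> d0; apply: (cvgM (lin c)); apply: cvgV (lin d); rewrite add0r.
have cr : r m @[m --> (0 : R)] --> r 0.
  apply: cvgM; first by apply: quo; rewrite invr_neq0.
  rewrite -addrA; under eq_fun do rewrite -addrA.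
  by apply: quo; rewrite gt_eqF.
apply: (cvgM cr).
apply/cvgrPdist_le => e e0; near=> m.
have m1 : `|m| <= 2^-1 by near: m; apply: cvgr0_norm_le => //; exact: cvg_id.
have me : `|m| <= e / 2 by near: m; apply: cvgr0_norm_le; [exact: cvg_id | rewrite divr_gt0].
move: (m1); rewrite ler_norml => /andP[? ?].
apply: le_trans (weight_mass_lip _ _ _ _) _; [lra|lra|].
by rewrite opprD addrACA subrr addr0 sub0r normrN mulrC -ler_pdivlMr.
Unshelve. all: by end_near. Qed.

End weight.

(** * Gegenbauer polynomials *)

Section gegenbauer.
Context {R : realType}.
Variable l : R.
Implicit Types (n k : nat) (P W : {poly R}).

(** The pair of the polynomials of indices [n - 1] and [n], the polynomial of
    index [-1] being zero. *)
Fixpoint geg_pair n : {poly R} * {poly R} :=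
  if n is m.+1 then
    let: (p, q) := geg_pair m in
    (q, m.+1%:R^-1 *: ((2 * (m%:R + l))%:P * 'X * q - (m%:R + 2 * l - 1)%:P * p))
  else (0, 1).

Definition geg n := (geg_pair n).2.
Definition geg_prev n := (geg_pair n).1.

Lemma geg_prevS n : geg_prev n.+1 = geg n.
Proof. by rewrite /geg_prev /geg /=; case: (geg_pair n). Qed.

Lemma geg_recl n : n.+1%:R * geg n.+1 =
  (2 * (n%:R + l))%:P * 'X * geg n - (n%:R + 2 * l - 1)%:P * geg_prev n.
Proof.
rewrite /geg_prev /geg /=; case: (geg_pair n) => p q /=.
by rewrite -mul_polyC mulrA -polyC_natr -polyCM divff ?mul1r// pnatr_eq0.
Qed.

Lemma geg_rec n : n.+2%:R * geg n.+2 =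
  (2 * (n.+1%:R + l))%:P * 'X * geg n.+1 - (n%:R + 2 * l)%:P * geg n.
Proof.
rewrite geg_recl geg_prevS; congr (_ - _%:P * _).
by rewrite -natr1; ring.
Qed.

(** The recurrence does not involve derivatives, so all three relations have to
    go through one induction: the first one at [n] gives the third one at [n],
    and together they give the first two at [n + 1]. *)
Lemma geg_deriv_rec n :
  [/\ 'X * (geg n)^`() - (geg_prev n)^`() = n%:R * geg n,
      (1 - 'X^2) * (geg n)^`() =
        (n%:R + 2 * l - 1)%:P * geg_prev n - n%:R * 'X * geg n
    & (geg n.+1)^`() = 'X * (geg n)^`() + (n%:R + 2 * l)%:P * geg n].
Proof.
have up m : 'X * (geg m)^`() - (geg_prev m)^`() = m%:R * geg m ->
    (geg m.+1)^`() = 'X * (geg m)^`() + (m%:R + 2 * l)%:P * geg m.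
  move=> am; have n0 : m.+1%:R != 0 :> {poly R} by rewrite -polyC_natr polyC_eq0 pnatr_eq0.
  apply: (mulfI n0).
  have -> : m.+1%:R * (geg m.+1)^`() = (m.+1%:R * geg m.+1)^`().
    by rewrite -polyC_natr derivM derivC mul0r add0r.
  rewrite geg_recl derivB !derivM !derivC derivX !mul0r !add0r.
  have -> : (geg_prev m)^`() = 'X * (geg m)^`() - m%:R * geg m by rewrite -am; ring.
  by rewrite -natr1; ring.
elim: n => [|n [an cn bn]].
  have a0 : 'X * (geg 0)^`() - (geg_prev 0)^`() = 0%:R * geg 0.
    by rewrite /geg /geg_prev /= -(polyC1 R) -(polyC0 R) !derivC; ring.
  split; [exact: a0| |exact: up].
  by rewrite /geg /geg_prev /= -(polyC1 R) derivC; ring.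
have an1 : 'X * (geg n.+1)^`() - (geg_prev n.+1)^`() = n.+1%:R * geg n.+1.
  rewrite geg_recl geg_prevS bn.
  have -> : (n%:R + 2 * l - 1)%:P * geg_prev n =
      (1 - 'X^2) * (geg n)^`() + n%:R * 'X * geg n by rewrite cn; ring.
  by ring.
split; [exact: an1| |exact: up].
have -> : n.+1%:R * 'X * geg n.+1 = 'X * (n.+1%:R * geg n.+1) by ring.
rewrite geg_recl geg_prevS bn.
have -> : (n%:R + 2 * l - 1)%:P * geg_prev n =
    (1 - 'X^2) * (geg n)^`() + n%:R * 'X * geg n by rewrite cn; ring.
by rewrite -natr1; ring.
Qed.

(** Differentiate the second relation of [geg_deriv_rec] and eliminate the
    polynomial of index [n - 1] by the first one. *)
Lemma geg_ode n : (1 - 'X^2) * (geg n)^`()^`() =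
  (2 * l + 1)%:P * 'X * (geg n)^`() - (n%:R * (n%:R + 2 * l))%:P * geg n.
Proof.
have [an cn _] := geg_deriv_rec n.
have := congr1 (@deriv R) cn.
rewrite derivB !derivM derivB derivXn derivX -!polyC_natr !derivC -(polyC1 R) ?derivC.
have -> : (geg_prev n)^`() = 'X * (geg n)^`() - n%:R * geg n by rewrite -an; ring.
rewrite -polyC_natr /= expr1 => h.
have -> : (1%:P - 'X^2) * (geg n)^`()^`() =
   ((0 - 'X *+ 2) * (geg n)^`() + (1%:P - 'X^2) * (geg n)^`()^`())
   + 2 * 'X * (geg n)^`() by ring.
by rewrite h; ring.
Qed.

(** At 1 the second relation of [geg_deriv_rec] loses its derivative and becomes
    a two-term recurrence. *)
Lemma geg_at1 n : (geg n).[1] * n`!%:R = pochhammer (2 * l) n.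
Proof.
elim: n => [|n IHn]; first by rewrite pochhammer0 mulr1 /geg /= hornerC.
have [_ + _] := geg_deriv_rec n.+1.
move/(congr1 (fun p : {poly R} => p.[1])).
rewrite geg_prevS !hornerE -!polyC_natr !hornerE => h.
rewrite pochhammerS -IHn factS natrM.
have h2 : n.+1%:R * (geg n.+1).[1] = (n%:R + 2 * l) * (geg n).[1].
  apply/eqP; rewrite -subr_eq0; apply/eqP; move: h; rewrite -natr1 => h.
  by apply: oppr_inj; rewrite oppr0 -[RHS](mul0r (geg n.+1)^`().[1]); move: h; lra.
by rewrite mulrA [_ * n.+1%:R]mulrC h2; ring.
Qed.

End gegenbauer.

(** * The square of a Gegenbauer polynomial *)

Section clausen.
Context {R : realType}.
Variable l : R.
Implicit Types (n k : nat) (P W : {poly R}).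

Lemma geg_parity n : geg l n \Po (- 'X) = (-1) ^+ n * geg l n.
Proof.
suff H m : geg l m \Po (- 'X) = (-1) ^+ m * geg l m /\
    geg_prev l m \Po (- 'X) = - (-1) ^+ m * geg_prev l m by have [] := H n.
elim: m => [|m [IH1 IH2]].
  by rewrite /geg /geg_prev /= !comp_polyC expr0 mul1r mulr0.
split; last by rewrite geg_prevS IH1 exprS mulN1r opprK.
have n0 : m.+1%:R != 0 :> {poly R} by rewrite -polyC_natr polyC_eq0 pnatr_eq0.
apply: (mulfI n0).
have -> : m.+1%:R * (geg l m.+1 \Po - 'X) = (m.+1%:R * geg l m.+1) \Po - 'X.
  by rewrite comp_polyM -polyC_natr comp_polyC.
rewrite [RHS]mulrCA geg_recl comp_polyB !comp_polyM !comp_polyC comp_polyX IH1 IH2.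
by rewrite exprS; ring.
Qed.

(** The polynomial [W] such that [P] is [W (1 - X ^ 2)], when [P] is even. *)
Definition even_part P : {poly R} := even_poly P \Po (1 - 'X).

Lemma even_part_geg_sqr n :
  even_part (geg l n ^+ 2) \Po (1 - 'X^2) = geg l n ^+ 2.
Proof.
set P := geg l n ^+ 2.
have PN : P \Po (- 'X) = P.
  by rewrite /P rmorphXn /= geg_parity exprMn -exprM mulnC exprM sqrrN !expr1n mul1r.
rewrite /even_part -comp_polyA comp_polyB comp_polyX -(polyC1 R) comp_polyC subKr.
have PE := poly_even_odd P.
have X2 : 'X^2 \Po (- 'X : {poly R}) = 'X^2 by rewrite rmorphXn /= comp_polyX sqrrN.
have := PN; rewrite -{1}PE comp_polyD comp_polyM -!comp_polyA X2 comp_polyX.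
rewrite -[RHS]PE => /eqP; rewrite mulrN -subr_eq0 opprD addrACA subrr add0r -opprD oppr_eq0.
rewrite -mulr2n -mulr_natr mulf_eq0 -polyC_natr polyC_eq0 pnatr_eq0 orbF => /eqP o0.
by rewrite -[RHS]PE o0 addr0.
Qed.

(** The squares of the solutions of a second order linear equation satisfy one
    of third order; here in terms of [S = 2 * (1 - x ^ 2) * (y') ^ 2]. *)
Lemma geg_sqr_ode n (P := geg l n ^+ 2) (N := (n%:R * (n%:R + 2 * l))%:P)
    (S := (1 - 'X^2) * P^`()^`() - (2 * l + 1)%:P * 'X * P^`() + 2 * N * P) :
  (1 - 'X^2) * (S^`() + 2 * N * P^`()) = (4 * l)%:P * 'X * S.
Proof.
have O := geg_ode l n; rewrite -/N in O; set y := geg l n in P S O *.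
have P1 : P^`() = 2 * y * y^`() by rewrite /P expr2 derivM; ring.
have P2 : P^`()^`() = 2 * y^`() ^+ 2 + 2 * y * y^`()^`().
  by rewrite P1 !derivM -(polyC_natr R 2) derivC; ring.
have SE : S = 2 * (1 - 'X^2) * y^`() ^+ 2.
  rewrite /S P2 P1 /P.
  have -> : (1 - 'X^2) * (2 * y^`() ^+ 2 + 2 * y * y^`()^`()) =
    2 * (1 - 'X^2) * y^`() ^+ 2 + 2 * y * ((1 - 'X^2) * y^`()^`()) by ring.
  by rewrite O; ring.
have S1 : S^`() = - 4 * 'X * y^`() ^+ 2 + 4 * y^`() * ((1 - 'X^2) * y^`()^`()).
  rewrite SE (expr2 y^`()) !derivM derivB derivXn -(polyC_natr R 2) -(polyC1 R) !derivC /= expr1.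
  by ring.
by rewrite S1 O P1 SE; ring.
Qed.

Section coefficients.
Variables (n : nat) (W : {poly R}).
Hypothesis WE : W \Po (1 - 'X^2) = geg l n ^+ 2.

Let X2 : {poly R} := 1 - 'X^2.

(** The equation of [geg_sqr_ode] in the variable [1 - X ^ 2]; all its terms have
    a common factor [X], from the chain rule. *)
Lemma clausen_ode (N := (n%:R * (n%:R + 2 * l))%:P)
    (s := 4%:P * 'X * W^`()^`() - 4%:P * 'X * ('X * W^`()^`()) - 2%:P * ('X * W^`()) +
      (2 * (2 * l + 1))%:P * (W^`() - 'X * W^`()) + 2%:P * N * W) :
  'X * (s^`() + 2%:P * N * W^`()) + (2 * l)%:P * s = 0.
Proof.
have X2E : X2^`() = - 2 * 'X.
  by rewrite /X2 derivB derivXn -(polyC1 R) derivC /= expr1; ring.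
have cN : N \Po X2 = N by rewrite comp_polyC.
have XX : 'X^2 = 1 - X2 :> {poly R} by rewrite /X2; ring.
have P1 : (W \Po X2)^`() = (W^`() \Po X2) * (- 2 * 'X) by rewrite deriv_comp X2E.
have P2 : (W \Po X2)^`()^`() =
    4 * (1 - X2) * (W^`()^`() \Po X2) - 2 * (W^`() \Po X2).
  rewrite P1 derivM deriv_comp X2E -XX.
  have -> : (- 2 * 'X : {poly R})^`() = - 2.
    by rewrite -polyC_natr -polyCN derivM derivC derivX; ring.
  by ring.
have := geg_sqr_ode n; cbv zeta; rewrite -WE -/N -/X2 P2 P1.
set S := X2 * _ - _ + _.
have SE : S = s \Po X2.
  rewrite /S /s !(cN, comp_polyB, comp_polyD, comp_polyM, comp_polyX, comp_polyC).
  have -> : (2 * l + 1)%:P * 'X * ((W^`() \Po X2) * (- 2 * 'X)) =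
    - 2 * (2 * l + 1)%:P * (1 - X2) * (W^`() \Po X2) by rewrite -XX; ring.
  by rewrite polyCM; ring.
rewrite {S}SE deriv_comp X2E; clearbody s N => h.
have X0 : (- 2 * 'X : {poly R}) != 0.
  by rewrite mulf_neq0 ?polyX_eq0// oppr_eq0 -polyC_natr polyC_eq0 pnatr_eq0.
apply/eqP; rewrite -(@comp_poly_eq0 _ _ X2); last first.
  by rewrite /X2 -opprB size_polyN -(polyC1 R) size_XnsubC.
rewrite !(cN, comp_polyB, comp_polyD, comp_polyM, comp_polyX, comp_polyC).
apply/eqP; apply: (mulIf X0); rewrite mul0r.
rewrite -(subrr ((4 * l)%:P * 'X * (s \Po X2))) -{1}h.
by ring.
Qed.

Lemma clausen_coef_rec k :
  (k%:R + 1) * (k%:R + l + 2^-1) * (k%:R + 2 * l) * W`_k.+1 =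
  (k%:R + l) * (k%:R - n%:R) * (k%:R + n%:R + 2 * l) * W`_k.
Proof.
have W1 j : W^`()`_j = W`_j.+1 * j.+1%:R by rewrite coef_deriv mulr_natr.
have XD (p : {poly R}) j : ('X * p^`())`_j = p`_j * j%:R.
  by rewrite coefXM; case: j => [|j] /=; rewrite ?mulr0 ?coef_deriv ?mulr_natr.
have XW2 j : ('X * W^`()^`())`_j = W`_j.+1 * j.+1%:R * j%:R.
  by rewrite coefXM; case: j => [|j] /=; rewrite ?mulr0 ?coef_deriv ?mulr_natr.
have XXW2 j : ('X * ('X * W^`()^`()))`_j = W`_j * j%:R * (j%:R - 1).
  rewrite coefXM; case: j => [|j] /=; rewrite ?mulr0 ?mul0r// XW2.
  by rewrite -natr1 addrK.
have := congr1 (fun p : {poly R} => p`_k) clausen_ode; cbv zeta.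
set s := (X in X^`()).
have sE j : s`_j = 2 * (j%:R + 1) * (2 * j%:R + 2 * l + 1) * W`_j.+1
   - (4 * j%:R ^+ 2 + 4 * l * j%:R - 2 * (n%:R * (n%:R + 2 * l))) * W`_j.
  rewrite /s -!mulrA !(coefD, coefN, coefCM) XXW2 !XD !W1 -natr1.
  by ring.
set c := (n%:R * (n%:R + 2 * l))%:P.
have -> : 'X * (s^`() + 2%:P * c * W^`()) = 'X * s^`() + 2%:P * (c * ('X * W^`())) by ring.
rewrite !coefD !coefCM coef0 !XD sE => h.
apply: (mulfI (_ : 4 != 0 :> R)); first by rewrite pnatr_eq0.
apply/eqP; rewrite -subr_eq0 -[X in _ == X]h; apply/eqP.
by field.
Qed.

(** Clausen's formula: the recurrence of the coefficients has two terms only, so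
    that they are products of linear factors. *)
Lemma clausen_coef (hl : 0 < l) k :
  W`_k = W`_0 * (pochhammer (- n%:R) k * pochhammer (n%:R + 2 * l) k * pochhammer l k) /
    (pochhammer (2 * l) k * pochhammer (l + 2^-1) k * k`!%:R).
Proof.
elim: k => [|k IHk]; first by rewrite !pochhammer0 !mulr1 divr1.
have k0 : 0 <= k%:R :> R by [].
have := clausen_coef_rec k; rewrite IHk => h.
have d1 : pochhammer (2 * l) k != 0 by rewrite gt_eqF// pochhammer_gt0//; lra.
have d2 : pochhammer (l + 2^-1) k != 0 by rewrite gt_eqF// pochhammer_gt0//; lra.
have d3 : k`!%:R != 0 :> R by rewrite pnatr_eq0 -lt0n fact_gt0.
have e1 : k%:R + 1 != 0 :> R by rewrite gt_eqF//; lra.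
have e2 : k%:R + l + 2^-1 != 0 by rewrite gt_eqF//; lra.
have e3 : k%:R + 2 * l != 0 by rewrite gt_eqF//; lra.
apply: (mulfI (mulf_neq0 (mulf_neq0 e1 e2) e3)); rewrite h.
rewrite !pochhammerS factS natrM -natr1.
field; do ?[apply/andP; split]; [exact: d3| | |exact: d2| |exact: d1];
  by rewrite gt_eqF//; lra.
Qed.

End coefficients.

End clausen.

(** * Orthogonality *)

Lemma poly_lin_ind {R : nzRingType} (Q : {poly R} -> Prop) :
  (forall k, Q 'X^k) -> Q 0 -> (forall p q, Q p -> Q q -> Q (p + q)) ->
  (forall c p, Q p -> Q (c%:P * p)) -> forall p, Q p.
Proof.
move=> QX Q0 QD QZ p; rewrite -[p]coefK poly_def.
by apply: (big_ind Q) => // i _; rewrite -mul_polyC; exact: QZ.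
Qed.

Lemma even_poly_comp_sqr {R : nzRingType} (q : {poly R}) : even_poly (q \Po 'X^2) = q.
Proof.
apply/polyP => i; rewrite coef_even_poly coef_comp_poly_Xn//.
by rewrite dvdn2 odd_double /= -muln2 mulnK.
Qed.

Lemma odd_poly_comp_sqr {R : nzRingType} (q : {poly R}) : odd_poly (q \Po 'X^2) = 0.
Proof.
apply/polyP => i; rewrite coef_odd_poly coef_comp_poly_Xn// coef0.
by rewrite dvdn2 /= odd_double.
Qed.

Section functional.
Context {R : realType}.
Variable mu : R.
Hypothesis hmu : - 2^-1 < mu.
Implicit Types (m n k : nat) (P W A B : {poly R}).

Let X2 : {poly R} := 1 - 'X^2.

(** The mean value of [(1 - x ^ 2) ^ k] for the weight of parameter [mu]. *)
Definition weight_ratio k : R := pochhammer (mu + 2^-1) k / pochhammer (mu + 1) k.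

(** The mean value of [W (1 - x ^ 2)]. *)
Definition moment_lin W : R := \sum_(k < size W) W`_k * weight_ratio k.

Lemma moment_lin_wide W m : (size W <= m)%N ->
  moment_lin W = \sum_(k < m) W`_k * weight_ratio k.
Proof.
move=> h; rewrite /moment_lin (big_ord_widen m (fun k => W`_k * weight_ratio k))//.
rewrite big_mkcond; apply: eq_bigr => k _; case: ltnP => // sk.
by rewrite nth_default ?mul0r.
Qed.

Lemma moment_linD A B : moment_lin (A + B) = moment_lin A + moment_lin B.
Proof.
set m := maxn (size A) (size B).
rewrite !(@moment_lin_wide _ m) ?leq_maxl ?leq_maxr ?size_polyD//.
by rewrite -big_split; apply: eq_bigr => k _; rewrite coefD mulrDl.
Qed.

Lemma moment_linC c A : moment_lin (c%:P * A) = c * moment_lin A.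
Proof.
rewrite (@moment_lin_wide _ (size A)); last by rewrite mul_polyC size_scale_leq.
by rewrite /moment_lin mulr_sumr; apply: eq_bigr => k _; rewrite coefCM mulrA.
Qed.

Lemma moment_lin0 : moment_lin 0 = 0.
Proof. by have := moment_linC 0 0; rewrite mulr0 mul0r. Qed.

Lemma moment_linXn k : moment_lin 'X^k = weight_ratio k.
Proof.
rewrite /moment_lin size_polyXn big_ord_recr /= coefXn eqxx mul1r.
rewrite big1 ?add0r// => i _.
by rewrite coefXn ltn_eqF ?mul0r.
Qed.

Lemma weight_ratioS k :
  (k%:R + mu + 1) * weight_ratio k.+1 = (k%:R + mu + 2^-1) * weight_ratio k.
Proof.
have k0 : 0 <= k%:R :> R by [].
have m0 : 0 < mu + 1 by move: hmu => h; lra.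
have P : pochhammer (mu + 1) k != 0 by rewrite gt_eqF// pochhammer_gt0.
rewrite /weight_ratio !pochhammerS; field.
by rewrite P /= gt_eqF//; lra.
Qed.

(** The mean value of a polynomial, in algebraic terms: the odd part contributes
    nothing, and the even one is a polynomial in [1 - X ^ 2]. *)
Definition moment P : R := moment_lin (even_part P).

Lemma momentD P Q : moment (P + Q) = moment P + moment Q.
Proof. by rewrite /moment /even_part even_polyD comp_polyD moment_linD. Qed.

Lemma momentC c P : moment (c%:P * P) = c * moment P.
Proof.
by rewrite /moment /even_part mul_polyC even_polyZ comp_polyZ -mul_polyC moment_linC.
Qed.

Lemma momentN P : moment (- P) = - moment P.
Proof. by rewrite -mulN1r -polyC1 -polyCN momentC mulN1r. Qed.

Lemma momentB P Q : moment (P - Q) = moment P - moment Q.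
Proof. by rewrite momentD momentN. Qed.

Lemma moment0 : moment 0 = 0.
Proof. by have := momentC 0 0; rewrite mulr0 mul0r. Qed.

Let X2E A : A \Po X2 = (A \Po (1 - 'X)) \Po 'X^2.
Proof. by rewrite -comp_polyA comp_polyB comp_polyX -(polyC1 R) comp_polyC. Qed.

Lemma moment_even A : moment (A \Po X2) = moment_lin A.
Proof.
rewrite /moment /even_part X2E even_poly_comp_sqr -comp_polyA comp_polyB comp_polyX.
by rewrite -(polyC1 R) comp_polyC subKr comp_polyXr.
Qed.

Lemma moment_odd A : moment ('X * (A \Po X2)) = 0.
Proof.
rewrite /moment /even_part X2E mulrC even_polyMX odd_poly_comp_sqr mul0r.
by rewrite comp_poly0 moment_lin0.
Qed.

Lemma even_odd_split P : exists A B, P = (A \Po X2) + 'X * (B \Po X2).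
Proof.
exists (even_poly P \Po (1 - 'X)), (odd_poly P \Po (1 - 'X)).
rewrite -!comp_polyA comp_polyB comp_polyX -(polyC1 R) comp_polyC.
by rewrite /X2 -(polyC1 R) subKr mulrC poly_even_odd.
Qed.

(** The fundamental theorem of calculus for [(1 - x ^ 2) ^ (mu + 1 / 2) * P x],
    which vanishes at both ends of the interval. *)
Lemma moment_deriv P : moment ((1 - 'X^2) * P^`() - (2 * mu + 1)%:P * 'X * P) = 0.
Proof.
have X2D : X2^`() = - 2%:P * 'X.
  by rewrite /X2 derivB derivXn -(polyC1 R) derivC /= expr1; ring.
have XX : 'X^2 = 1%:P - X2 :> {poly R} by rewrite /X2 polyC1; ring.
have [A [B ->]] := even_odd_split P.
rewrite -/X2 derivD derivM !deriv_comp derivX X2D.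
have -> : X2 * ((A^`() \Po X2) * (- 2%:P * 'X) +
     (1 * (B \Po X2) + 'X * ((B^`() \Po X2) * (- 2%:P * 'X)))) -
   (2 * mu + 1)%:P * 'X * ((A \Po X2) + 'X * (B \Po X2)) =
   'X * ((- 2%:P * ('X * A^`()) - (2 * mu + 1)%:P * A) \Po X2) +
   (('X * B - 2%:P * (1%:P - 'X) * ('X * B^`()) - (2 * mu + 1)%:P * (1%:P - 'X) * B)
     \Po X2).
  rewrite -mulNr -polyCN !(comp_polyB, comp_polyD, comp_polyM, comp_polyX, comp_polyC) -XX.
  by ring.
rewrite momentD moment_odd add0r moment_even.
move: B; apply: poly_lin_ind => [k||p q IHp IHq|c p IHp].
- have -> : 'X * ('X^k)^`() = k%:R%:P * 'X^k :> {poly R}.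
    by rewrite derivXn; case: k => [|k] /=; rewrite ?mulr0n ?mulr0 ?mul0r// exprS polyC_natr; ring.
  have -> : 'X * 'X^k - 2%:P * (1%:P - 'X) * (k%:R%:P * 'X^k) -
      (2 * mu + 1)%:P * (1%:P - 'X) * 'X^k =
      (2 * (k%:R + mu + 1))%:P * 'X^(k.+1) + (- 2 * (k%:R + mu + 2^-1))%:P * 'X^k.
    have -> : - 2 * (k%:R + mu + 2^-1) = - (2 * k%:R + 2 * mu + 1) by field.
    by rewrite exprS; ring.
  rewrite moment_linD !moment_linC !moment_linXn -mulrA weight_ratioS; ring.
- by rewrite deriv0 !mulr0 !subr0 moment_lin0.
- rewrite derivD -[RHS](addr0 0) -{1}IHp -{1}IHq -moment_linD; congr moment_lin; ring.
- rewrite derivM derivC -(mulr0 c) -{1}IHp -moment_linC; congr moment_lin; ring.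
Qed.

(** For the Wronskian of the two polynomials, the expression in [moment_deriv] is
    their product times the difference of the eigenvalues [n * (n + 2 * mu)],
    by the differential equation. *)
Lemma geg_orthogonal m n : m != n -> moment (geg mu m * geg mu n) = 0.
Proof.
move=> mn; have Om := geg_ode mu m; have On := geg_ode mu n.
have := moment_deriv ((geg mu m)^`() * geg mu n - geg mu m * (geg mu n)^`()).
rewrite derivB !derivM.
set a := geg mu m in Om *; set b := geg mu n in On *.
have -> : (1 - 'X^2) * (a^`()^`() * b + a^`() * b^`() - (a^`() * b^`() + a * b^`()^`())) =
  ((1 - 'X^2) * a^`()^`()) * b - a * ((1 - 'X^2) * b^`()^`()) by ring.
rewrite Om On.
set c := n%:R * (n%:R + 2 * mu) - m%:R * (m%:R + 2 * mu).
rewrite (_ : _ - _ = c%:P * (a * b)); last by rewrite /c; ring.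
rewrite momentC => /eqP; rewrite mulf_eq0 => /orP[/eqP c0|/eqP//].
have : (n%:R - m%:R) * ((m + n)%:R + 2 * mu) == 0 :> R.
  by rewrite -c0 /c natrD; apply/eqP; ring.
rewrite mulf_eq0 subr_eq0 eqr_nat eq_sym (negbTE mn) /= => /eqP h.
have : 1 <= (m + n)%:R :> R.
  by rewrite ler1n lt0n addn_eq0; apply: contra mn => /andP[/eqP-> /eqP->].
by move: hmu => h'; lra.
Qed.

(** Multiplying the recurrence by a neighbouring polynomial in two ways links
    consecutive norms. *)
Lemma geg_norm m : moment (geg mu m ^+ 2) * (m%:R + mu) * m`!%:R =
  mu * pochhammer (2 * mu) m.
Proof.
elim: m => [|m IHm].
  have -> : geg mu 0 ^+ 2 = 1 \Po X2 by rewrite /geg /= expr1n -(polyC1 R) comp_polyC.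
  rewrite moment_even -(expr0 'X) moment_linXn /weight_ratio !pochhammer0.
  by rewrite divr1 mul1r add0r mulr1.
have prev0 : moment (geg_prev mu m * geg mu m.+1) = 0.
  case: m {IHm} => [|m]; first by rewrite /geg_prev /= mul0r moment0.
  by rewrite geg_prevS geg_orthogonal// ltn_eqF// ltnW.
have E1 : m.+1%:R * moment (geg mu m.+1 ^+ 2) =
    2 * (m%:R + mu) * moment ('X * geg mu m * geg mu m.+1).
  rewrite -!momentC expr2 mulrA polyC_natr geg_recl mulrBl momentB.
  by rewrite -!mulrA [X in _ - X]momentC prev0 mulr0 subr0 !mulrA.
have E2 : 2 * (m.+1%:R + mu) * moment ('X * geg mu m * geg mu m.+1) =
    (m%:R + 2 * mu) * moment (geg mu m ^+ 2).
  have : moment (m.+2%:R * geg mu m.+2 * geg mu m) = 0.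
    by rewrite -mulrA -polyC_natr momentC geg_orthogonal ?mulr0// gtn_eqF// ltnW.
  rewrite geg_rec mulrBl momentB => /eqP; rewrite subr_eq0 => /eqP.
  rewrite -![_ * _ * geg mu m]mulrA !momentC => h.
  have -> : 'X * geg mu m * geg mu m.+1 = 'X * geg mu m.+1 * geg mu m by ring.
  by rewrite expr2 -h -[_ * _ * geg mu m]mulrA -momentC mulrA.
rewrite pochhammerS mulrA -IHm factS natrM.
have m0 : m.+1%:R != 0 :> R by rewrite pnatr_eq0.
have -> : moment (geg mu m.+1 ^+ 2) * (m.+1%:R + mu) * (m.+1%:R * m`!%:R) =
   (m.+1%:R * moment (geg mu m.+1 ^+ 2)) * (m.+1%:R + mu) * m`!%:R by ring.
rewrite E1; have -> : 2 * (m%:R + mu) * moment ('X * geg mu m * geg mu m.+1) *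
    (m.+1%:R + mu) * m`!%:R =
  (m%:R + mu) * (2 * (m.+1%:R + mu) * moment ('X * geg mu m * geg mu m.+1)) * m`!%:R.
  by ring.
by rewrite E2; ring.
Qed.

End functional.

(** * Connection between two parameters *)

Section connection.
Context {R : realType}.
Implicit Types (l mu : R) (n k j : nat).

(** The polynomial of index [n - 2 * k], zero when this is negative, so that
    sums over [k] need no boundary terms. *)
Definition geg_down mu n k : {poly R} :=
  if (k.*2 <= n)%N then geg mu (n - k.*2) else 0.

Lemma geg_down_SS mu n k : geg_down mu n.+2 k.+1 = geg_down mu n k.
Proof. by rewrite /geg_down doubleS !ltnS !subSS. Qed.

Lemma geg_down_big mu n k : (n < k.*2)%N -> geg_down mu n k = 0.
Proof. by rewrite /geg_down ltnNge => /negbTE ->. Qed.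

Lemma geg_down_rec mu n k :
  (2 * (n%:R - 2 * k%:R + mu))%:P * 'X * geg_down mu n k =
  (n%:R - 2 * k%:R + 1)%:P * geg_down mu n.+1 k +
  (n%:R - 2 * k%:R + 2 * mu - 1)%:P * geg_down mu n.+1 k.+1.
Proof.
have [kn|nk] := leqP k.*2 n; last first.
  rewrite (geg_down_big _ _ _ nk) mulr0 [geg_down _ _ k.+1]geg_down_big; last first.
    by rewrite doubleS ltnS ltnW// ltnS ltnW.
  rewrite mulr0 addr0; have [nk'|nk'] := eqVneq k.*2 n.+1; last first.
    by rewrite geg_down_big ?mulr0// ltn_neqAle eq_sym nk'.
  have -> : n%:R - 2 * k%:R + 1 = 0 :> R.
    by rewrite -natrM mul2n nk' -natr1; ring.
  by rewrite mul0r.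
have [m nE] : exists m, n = (m + k.*2)%N by exists (n - k.*2)%N; rewrite subnK.
have -> : geg_down mu n k = geg mu m by rewrite /geg_down kn nE addnK.
have -> : geg_down mu n.+1 k = geg mu m.+1.
  by rewrite /geg_down nE -addSn leq_addl addnK.
have -> : geg_down mu n.+1 k.+1 = geg_prev mu m.
  case: m nE => [|m] nE; last by rewrite geg_prevS nE addSn geg_down_SS /geg_down leq_addl addnK.
  by rewrite geg_down_big// doubleS nE.
have -> : n%:R - 2 * k%:R = m%:R :> R.
  by rewrite nE natrD -mul2n natrM; ring.
have -> : (m%:R + 1 : R)%:P = m.+1%:R by rewrite natr1 polyC_natr.
by rewrite geg_recl; ring.
Qed.

Definition connection_coef l mu n k : R :=
  pochhammer (l - mu) k * pochhammer l (n - k) /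
    (k`!%:R * pochhammer (mu + 1) (n - k) * mu).

Section parameters.
Variables l mu : R.
Hypotheses (hmu : - 2^-1 < mu) (mu0 : mu != 0).

Let e n k := connection_coef l mu n k.

Let D n : {poly R} :=
  \sum_(k < n.+1) (e n k * (n%:R - 2 * k%:R + mu))%:P * geg_down mu n k.

Let pneq0 n : pochhammer (mu + 1) n != 0.
Proof. by rewrite gt_eqF// pochhammer_gt0//; move: hmu => h; lra. Qed.

Let fneq0 k : k`!%:R != 0 :> R.
Proof. by rewrite pnatr_eq0 -lt0n fact_gt0. Qed.

Let jneq0 j : mu + 1 + j%:R != 0.
Proof. have : 0 <= j%:R :> R by []. by move: hmu => h *; rewrite gt_eqF//; lra. Qed.

(* The coefficients, at the polynomial of index [n - 2 * k] and parameter [mu],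
   of the two sides of the recurrence of parameter [l]. *)
Let e_rec n k : (k <= n)%N ->
  n.+2%:R * (e n.+2 k.+1 * (n.+2%:R - 2 * k.+1%:R + mu)) =
  (n.+1%:R + l) * (e n.+1 k.+1 * (n.+1%:R - 2 * k.+1%:R + 1)
    + e n.+1 k * (n.+1%:R - 2 * k%:R + 2 * mu - 1))
  - (n%:R + 2 * l) * (e n k * (n%:R - 2 * k%:R + mu)).
Proof.
move=> kn; have [j ->] : exists j, n = (j + k)%N by exists (n - k)%N; rewrite subnK.
rewrite /e /connection_coef !subSS -!addSn !addnK !addSn.
rewrite !pochhammerS factS natrM -[_.+2%:R]natr1 -![_.+1%:R]natr1 natrD.
field; rewrite /= fneq0 pneq0 mu0 jneq0.
by rewrite natr1 pnatr_eq0.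
Qed.

(** The expansion satisfies the recurrence of parameter [l]: its product by ['X]
    is computed by the recurrence of parameter [mu], and the coefficients agree
    by [e_rec]. *)
Lemma geg_connection_down n : geg l n = D n.
Proof.
suff H m : geg l m = D m /\ geg l m.+1 = D m.+1 by have [] := H n.
elim: m => [|m [IH0 IH1]].
  have d0 : geg_down mu 0 0 = 1 by [].
  split.
    rewrite /D big_ord1 /e /connection_coef subnn !pochhammer0 d0 mulr1.
    rewrite -[LHS]/(1 : {poly R}) -(polyC1 R); congr polyC.
    by rewrite fact0 /=; field.
  rewrite /D big_ord_recl big_ord1 [geg_down _ _ (lift _ _)]geg_down_big//.
  rewrite [X in _ + X]mulr0 /= addr0 -[geg l 1]mul1r -[1]/(1%:R) geg_recl.
  have -> : geg_down mu 1 0 = 1%:R * geg mu 1 by rewrite mul1r.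
  rewrite geg_recl /geg /geg_prev /= !mulr1 !mulr0 !subr0.
  rewrite mulrA -polyCM; congr (_%:P * _).
  rewrite /e /connection_coef subn0 !pochhammerS !pochhammer0 fact0 /=.
  by field; rewrite mu0 /=; have := jneq0 0; rewrite addr0.
split=> //; have n0 : m.+2%:R != 0 :> {poly R} by rewrite -polyC_natr polyC_eq0 pnatr_eq0.
apply: (mulfI n0); rewrite geg_rec IH0 IH1 {IH0 IH1}.
pose G k := geg_down mu m.+2 k.
pose a k := (m.+1%:R + l) * (e m.+1 k * (m.+1%:R - 2 * k%:R + 1)).
pose b k := (m.+1%:R + l) * (e m.+1 k * (m.+1%:R - 2 * k%:R + 2 * mu - 1)).
pose c k := (m%:R + 2 * l) * (e m k * (m%:R - 2 * k%:R + mu)).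
pose f k := m.+2%:R * (e m.+2 k * (m.+2%:R - 2 * k%:R + mu)).
have -> : (2 * (m.+1%:R + l))%:P * 'X * D m.+1 =
    \sum_(k < m.+2) (a k)%:P * G k + \sum_(k < m.+2) (b k)%:P * G k.+1.
  rewrite -big_split mulr_sumr; apply: eq_bigr => k _ /=.
  have := geg_down_rec mu m.+1 k => h.
  have -> : (2 * (m.+1%:R + l))%:P * 'X *
      ((e m.+1 k * (m.+1%:R - 2 * k%:R + mu))%:P * geg_down mu m.+1 k) =
    ((m.+1%:R + l) * e m.+1 k)%:P *
      ((2 * (m.+1%:R - 2 * k%:R + mu))%:P * 'X * geg_down mu m.+1 k) by ring.
  by rewrite h /a /b /G; ring.
have -> : (m%:R + 2 * l)%:P * D m = \sum_(k < m.+1) (c k)%:P * G k.+1.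
  rewrite mulr_sumr; apply: eq_bigr => k _; rewrite /G geg_down_SS /c.
  by rewrite [in RHS]polyCM mulrA.
have -> : m.+2%:R * D m.+2 = \sum_(k < m.+3) (f k)%:P * G k.
  rewrite mulr_sumr; apply: eq_bigr => k _.
  by rewrite /f [in RHS]polyCM polyC_natr mulrA.
have Gbig : G m.+2 = 0 by rewrite /G geg_down_big// -addnn -[ltnLHS]addn0 ltn_add2l.
rewrite big_ord_recl [X in _ + X - _]big_ord_recr [RHS]big_ord_recl [in RHS]big_ord_recr /=.
rewrite /bump /= add1n Gbig !mulr0 !addr0.
have -> : a 0 = f 0.
  rewrite /a /f /e /connection_coef !subn0 pochhammer0 (pochhammerS l m.+1) (pochhammerS (mu + 1) m.+1).
  rewrite fact0 -(natr1 m.+1).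
  have j0 := jneq0 m.+1; have p0 := pneq0 m.+1.
  by field; rewrite mu0 p0 (addrC 1) natr1 j0.
rewrite -!addrA; congr (_ + _).
rewrite -sumrN -!big_split; apply: eq_bigr => k _ /=.
rewrite !add1n /f e_rec; last by rewrite -ltnS.
by rewrite /a /b /c; ring.
Qed.

Lemma geg_connection n :
  geg l n = \sum_(k < n./2.+1) (e n k * (n%:R - 2 * k%:R + mu))%:P * geg mu (n - k.*2).
Proof.
rewrite geg_connection_down /D.
have hn : (n./2.+1 <= n.+1)%N by rewrite ltnS leq_half_double -addnn; lia.
rewrite [RHS](big_ord_widen n.+1
  (fun k => (e n k * (n%:R - 2 * k%:R + mu))%:P * geg mu (n - k.*2)))//.
rewrite [RHS]big_mkcond; apply: eq_bigr => k _.
by rewrite /geg_down ltnS geq_half_double; case: ifP; rewrite ?mulr0.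
Qed.

Lemma moment_suml (I : Type) (r : seq I) (F : I -> {poly R}) P :
  moment mu ((\sum_(i <- r) F i) * P) = \sum_(i <- r) moment mu (F i * P).
Proof.
by rewrite mulr_suml; exact: (big_morph _ (momentD mu) (moment0 mu)).
Qed.

(** Parseval's identity for the connection formula. *)
Lemma moment_geg_sqr n : moment mu (geg l n ^+ 2) =
  mu^-1 * \sum_(k < n./2.+1)
    (pochhammer l (n - k) ^+ 2 * pochhammer (l - mu) k ^+ 2)
      / (pochhammer (mu + 1) (n - k) ^+ 2 * k`!%:R ^+ 2)
    * (n%:R + mu - 2 * k%:R)
    * (pochhammer (2 * mu) (n - k.*2) / (n - k.*2)`!%:R).
Proof.
have idx (k : 'I_n./2.+1) : (k.*2 <= n)%N by rewrite -geq_half_double -ltnS.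
rewrite expr2 {1}geg_connection moment_suml mulr_sumr.
apply: eq_bigr => k _.
rewrite -mulrA momentC [geg mu _ * _]mulrC geg_connection moment_suml (bigD1 k)//= big1 ?addr0; last first.
  move=> i ik; rewrite -mulrA momentC geg_orthogonal ?mulr0//.
  apply: contra ik => /eqP h; apply/eqP/val_inj => /=.
  have := idx k; have := idx i; rewrite -!muln2 in h *; lia.
rewrite -mulrA momentC -expr2 mulrC.
have := geg_norm mu hmu (n - k.*2); set m := (n - k.*2)%N.
have -> : n%:R = m%:R + 2 * k%:R :> R by rewrite /m natrB// -mul2n natrM subrK.
move=> h; have h' : moment mu (geg mu m ^+ 2) * (m%:R + mu) =
    mu * pochhammer (2 * mu) m / m`!%:R by rewrite -h mulfK.
have -> : m%:R + 2 * k%:R - 2 * k%:R + mu = m%:R + mu by ring.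
have -> : m%:R + 2 * k%:R + mu - 2 * k%:R = m%:R + mu by ring.
rewrite /e /connection_coef.
rewrite [LHS](_ : _ = (pochhammer (l - mu) k * pochhammer l (n - k) /
    (k`!%:R * pochhammer (mu + 1) (n - k) * mu)) ^+ 2 * (m%:R + mu) *
    (moment mu (geg mu m ^+ 2) * (m%:R + mu))); last by ring.
by rewrite h'; field; rewrite /= !fneq0 pneq0 mu0.
Qed.

End parameters.

End connection.

(** * The generating function *)

Section power_series.
Context {R : realType}.
Implicit Types (c : nat -> R) (x z K : R) (n : nat).

(** Each [a ^ i] with [i <= n] is at least [a ^ n], and the geometric series sums
    to the right-hand side. *)
Lemma natr_mul_exp_le (a : R) n : 0 <= a -> a < 1 -> n.+1%:R * a ^+ n <= (1 - a)^-1.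
Proof.
move=> a0 a1.
have h : n.+1%:R * a ^+ n <= \sum_(i < n.+1) a ^+ i.
  rewrite mulr_natl -[X in _ *+ X](card_ord n.+1) -sumr_const.
  by apply: ler_sum => i _; apply: ler_wiXn2l; [|exact: ltW|rewrite -ltnS].
apply: le_trans h _; have d0 : 0 < 1 - a by lra.
rewrite -[leRHS]mul1r ler_pdivlMr// mulrC.
have := subrXX (1 : R) a n.+1.
under eq_bigr => i _ do rewrite expr1n mul1r.
by move=> <-; rewrite expr1n gerBl exprn_ge0.
Qed.

(** The terms [c n * K ^ n] are bounded. A radius [r] between [`|x|] and [`|K|]
    leaves a geometric factor [(r / `|K|) ^ n] for the convergence, and
    [(`|x| / r) ^ n] to absorb the factor [n + 1]. *)
Lemma is_cvg_pseries_diffs c K x :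
  cvgn (pseries c K) -> `|x| < `|K| -> cvgn (pseries (pseries_diffs c) x).
Proof.
move=> cK xK.
have K0 : 0 < `|K| by apply: le_lt_trans xK.
have [B [_ hB]] := cvg_series_bounded cK.
pose r := (`|x| + `|K|) / 2.
have rx : `|x| < r by rewrite /r; lra.
have rK : r < `|K| by rewrite /r; lra.
have r0 : 0 < r by apply: le_lt_trans rx.
clearbody r.
pose a := `|x| / r; pose b := r / `|K|.
have a0 : 0 <= a by rewrite divr_ge0// ltW.
have a1 : a < 1 by rewrite ltr_pdivrMr// mul1r.
have b0 : 0 <= b by rewrite divr_ge0// ltW.
have b1 : b < 1 by rewrite ltr_pdivrMr// mul1r.
have M0 : 0 <= (`|B| + 1) / `|K| * (1 - a)^-1.
  by rewrite mulr_ge0 ?divr_ge0 ?addr_ge0// invr_ge0 subr_ge0 ltW.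
have hB' n : `|c n * K ^+ n| <= `|B| + 1.
  by apply: hB => //; rewrite (le_lt_trans (ler_norm B))// ltrDl.
apply: normed_cvg.
apply: (@series_le_cvg _ _ (fun n => (`|B| + 1) / `|K| * (1 - a)^-1 * b ^+ n)).
- by move=> n /=.
- by move=> n /=; rewrite mulr_ge0 ?exprn_ge0.
- move=> n /=; rewrite /pseries_diffs.
  have -> : `|n.+1%:R * c n.+1 * x ^+ n| =
      `|c n.+1 * K ^+ n.+1| / `|K| * (n.+1%:R * a ^+ n) * b ^+ n.
    rewrite !normrM !normrX normr_nat exprS /a /b !exprMn !exprVn.
    by field; rewrite !expf_neq0 ?gt_eqF.
  rewrite ler_wpM2r ?exprn_ge0// ler_pM//.
  + by rewrite mulr_ge0 ?exprn_ge0.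
  + by rewrite ler_pM2r ?invr_gt0.
  + exact: natr_mul_exp_le.
- by apply: (@is_cvg_geometric_series _ _ b); rewrite ger0_norm.
Qed.

Lemma is_derive_pseries c K x : cvgn (pseries c K) -> `|x| < `|K| ->
  is_derive x (1 : R) (fun z => limn (pseries c z)) (limn (pseries (pseries_diffs c) x)).
Proof.
move=> cK xK.
(* The first two derived series have to converge at [q]: each differentiation
   costs a smaller radius. *)
pose p := (`|x| + `|K|) / 2; pose q := (`|x| + p) / 2.
have h0 : 0 <= `|x| by [].
have p0 : 0 <= p by rewrite /p; lra.
have q0 : 0 <= q by rewrite /q; lra.
have pK : `|p| < `|K| by rewrite (ger0_norm p0) /p; lra.
have qp : `|q| < `|p| by rewrite (ger0_norm p0) (ger0_norm q0) /q /p; lra.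
have xq : `|x| < `|q| by rewrite (ger0_norm q0) /q /p; lra.
have dp := is_cvg_pseries_diffs _ _ _ cK pK.
apply: (@pseries_snd_diffs _ c q) => //.
- by apply: is_cvg_pseries_inside cK _; apply: lt_trans pK.
- exact: is_cvg_pseries_inside dp _.
- exact: is_cvg_pseries_diffs dp _.
Qed.

Lemma pseries_at0 c : pseries c 0 @ \oo --> c 0.
Proof.
rewrite -cvg_shiftS; apply: (cvg_trans _ (@cvg_cst _ (c 0%N) _ \oo _)).
apply: near_eq_cvg; near=> n.
rewrite /pseries /series /= big_nat_recl// expr0 mulr1 big1 ?addr0// => i _.
by rewrite expr0n mulr0.
Unshelve. all: by end_near. Qed.

Definition nearly_zero_series c := \forall z \near (0 : R), pseries c z @ \oo --> (0 : R).

Lemma nearly_zero_seriesP c : nearly_zero_series c ->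
  exists2 e : R, 0 < e & forall z, `|z| < e -> pseries c z @ \oo --> (0 : R).
Proof.
move=> /nbhs_ballP[e /= e0 he]; exists e => // z ze.
by apply: he; rewrite /ball /= sub0r normrN.
Qed.

Lemma nearly_zero_series_diffs c :
  nearly_zero_series c -> nearly_zero_series (pseries_diffs c).
Proof.
move=> /nearly_zero_seriesP[e e0 he].
have e2 : 0 < e / 2 by rewrite divr_gt0.
have ce : cvgn (pseries c (e / 2)).
  by apply/cvg_ex; exists 0; apply: he; rewrite ger0_norm ?ltW//; lra.
apply/nbhs_ballP; exists (e / 2) => //= z; rewrite /ball /= sub0r normrN => ze.
have ze' : `|z| < `|e / 2| by rewrite [ltRHS]ger0_norm// ltW.
have D := is_derive_pseries _ _ _ ce ze'.
have dc : cvgn (pseries (pseries_diffs c) z) by apply: is_cvg_pseries_diffs ze'.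
suff <- : limn (pseries (pseries_diffs c) z) = 0 by [].
have <- : 'D_1 (fun z => limn (pseries c z)) z = limn (pseries (pseries_diffs c) z).
  by apply: derive_val.
rewrite (near_eq_derive (g := cst 0)); [by rewrite derive_cst|].
near=> t; apply/cvg_lim => //; apply: he.
have : `|t| < e / 2; last by lra.
by near: t; apply: (cvgr_lt `|z|) => //; apply: cvg_norm; exact: cvg_id.
Unshelve. all: by end_near. Qed.

(** The value at 0 is the coefficient of index 0, and differentiation shifts the
    other coefficients down. *)
Lemma nearly_zero_seriesE c n : nearly_zero_series c -> c n = 0.
Proof.
elim: n c => [|n IHn] c hc.
  have [e e0 he] := nearly_zero_seriesP _ hc.
  have /he h0 : `|0 : R| < e by rewrite normr0.
  by rewrite -(cvg_lim (@norm_hausdorff _ _) (pseries_at0 c)) (cvg_lim (@norm_hausdorff _ _) h0).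
have := IHn _ (nearly_zero_series_diffs _ hc); rewrite /pseries_diffs => /eqP.
by rewrite mulf_eq0 pnatr_eq0 /= => /eqP.
Qed.

Definition shift_seq c n : R := if n is m.+1 then c m else 0.

Lemma cvg_pseries_shift c z (a : R) :
  pseries c z @ \oo --> a -> pseries (shift_seq c) z @ \oo --> z * a.
Proof.
move=> ca; rewrite -cvg_shiftS.
rewrite (_ : (fun n => _) = (fun n => z * pseries c z n)); first exact: cvgMr.
apply/funext => n; rewrite /pseries /series /= big_nat_recl//= mul0r add0r mulr_sumr.
by apply: eq_bigr => i _; rewrite exprS; ring.
Qed.

Lemma cvg_pseriesD c d z (a b : R) : pseries c z @ \oo --> a ->
  pseries d z @ \oo --> b -> pseries (fun n => c n + d n) z @ \oo --> a + b.
Proof.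
move=> ca db.
rewrite (_ : pseries _ z = pseries c z \+ pseries d z); first exact: cvgD.
apply/funext => n; rewrite /pseries /series /= -big_split.
by apply: eq_bigr => i _; rewrite mulrDl.
Qed.

Lemma cvg_pseriesZ c z (k a : R) : pseries c z @ \oo --> a ->
  pseries (fun n => k * c n) z @ \oo --> k * a.
Proof.
move=> ca.
rewrite (_ : pseries _ z = (fun n => k * pseries c z n)); first exact: cvgMr.
apply/funext => n; rewrite /pseries /series /= mulr_sumr.
by apply: eq_bigr => i _; rewrite mulrA.
Qed.

End power_series.

Section generating_function.
Context {R : realType}.
Variables (l : R) (C : nat -> {poly R}).
Hypothesis hC : is_gegenbauer l C.

(** With [w = 1 - 2 * x * z + z ^ 2], the function [f = w ^ (- l)] satisfies
    [w * f' = 2 * l * (x - z) * f]; comparing coefficients gives the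
    recurrence. *)
Lemma gegenbauer_coef (x : R) : (C 0).[x] = 1 /\
  (C 1).[x] = 2 * l * x /\ forall n,
  n.+2%:R * (C n.+2).[x] =
    2 * (n.+1%:R + l) * x * (C n.+1).[x] - (n%:R + 2 * l) * (C n).[x].
Proof.
pose c n := (C n).[x].
pose w z : R := 1 - 2 * x * z + z ^+ 2.
have cw z : {for z, continuous w}.
  by apply: cvgD; [apply: cvgB; [exact: cvg_cst|apply: cvgMr; exact: cvg_id]|exact: exprn_continuous].
have w0 : w 0 = 1 by rewrite /w mulr0 expr0n subr0 addr0.
have [e e0 he] : exists2 e : R, 0 < e &
    forall z, `|z| < e -> 0 < w z /\ pseries c z @ \oo --> w z `^ (- l).
  have : \forall z \near (0 : R), 0 < w z /\ pseries c z @ \oo --> w z `^ (- l).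
    near=> z; split; last by near: z; exact: hC.
    near: z; apply: (cvgr_gt (w 0)); first exact: cw.
    by rewrite w0.
  move=> /nbhs_ballP[e /= e0 he]; exists e => // z ze.
  by apply: he; rewrite /ball /= sub0r normrN.
have e2 : 0 < e / 2 by rewrite divr_gt0.
have ce : cvgn (pseries c (e / 2)).
  by apply/cvg_ex; exists (w (e / 2) `^ (- l)); apply: (he _ _).2; rewrite ger0_norm ?ltW//; lra.
pose dc := pseries_diffs c.
pose d n := dc n + (- (2 * x)) * shift_seq dc n + shift_seq (shift_seq dc) n
  + (- (2 * l * x)) * c n + 2 * l * shift_seq c n.
have d0 : nearly_zero_series d.
  apply/nbhs_ballP; exists (e / 2) => //= z; rewrite /ball /= sub0r normrN => ze.
  have ze' : `|z| < `|e / 2| by rewrite [ltRHS]ger0_norm// ltW.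
  have ze1 : `|z| < e by lra.
  have [wz0 fz] := he z ze1.
  have D := is_derive_pseries _ _ _ ce ze'.
  have dcz := is_cvg_pseries_diffs _ _ _ ce ze'.
  set g := limn (pseries dc z) in D dcz.
  have gE : w z * g = 2 * l * (x - z) * w z `^ (- l).
    have <- : 'D_1 (fun z => limn (pseries c z)) z = g by apply: derive_val.
    rewrite (near_eq_derive (g := fun t => w t `^ (- l))); last first.
      near=> t; apply/cvg_lim => //; apply: (he _ _).2.
      have : `|t| < e / 2; last by lra.
      by near: t; apply: (cvgr_lt `|z|) => //; apply: cvg_norm; exact: cvg_id.
    have Dw : is_derive z 1 w (- (2 * x) + 2 * z).
      by apply: is_derive_eq; rewrite /GRing.scale /=; ring.
    have Dp := is_derive1_powR (- l) wz0.
    have -> : 'D_1 (fun t => w t `^ (- l)) z = - l * w z `^ (- l - 1) * (- (2 * x) + 2 * z).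
      by have Dc := is_derive1_comp Dp Dw; apply: derive_val.
    have -> : w z `^ (- l) = w z * w z `^ (- l - 1).
      rewrite -{2}[w z]powRr1 ?ltW// -powRD; last by rewrite (gt_eqF wz0) implybT.
      by congr powR; ring.
    by ring.
  rewrite (_ : 0 = g + (- (2 * x)) * (z * g) + z * (z * g) + (- (2 * l * x)) * w z `^ (- l)
     + 2 * l * (z * w z `^ (- l))); last first.
    by move: gE; rewrite /w; lra.
  have dcz' : pseries dc z @ \oo --> g by exact: dcz.
  apply: cvg_pseriesD; last by apply/cvg_pseriesZ/cvg_pseries_shift.
  apply: cvg_pseriesD; last exact: cvg_pseriesZ.
  apply: cvg_pseriesD; last by do 2!apply: cvg_pseries_shift.
  apply: cvg_pseriesD => //.
  by apply/cvg_pseriesZ/cvg_pseries_shift.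
have dn n := nearly_zero_seriesE _ n d0.
have c0 : c 0 = 1.
  have /he[_] : `|0 : R| < e by rewrite normr0.
  rewrite w0 powR1 => h0.
  by rewrite -(cvg_lim (@norm_hausdorff _ _) (pseries_at0 c)) (cvg_lim (@norm_hausdorff _ _) h0).
split=> //; split.
  have := dn 0%N; rewrite /d /dc /pseries_diffs /= c0; rewrite /c; lra.
move=> n; have := dn n.+1; rewrite /d /dc /=.
have -> : shift_seq (pseries_diffs c) n = n%:R * c n.
  by case: n => [|n] //=; rewrite mul0r.
rewrite /pseries_diffs -/(c n.+2) -/(c n.+1) -/(c n) => h.
apply/eqP; rewrite -subr_eq0 -[X in _ == X]h; apply/eqP.
by ring.
Unshelve. all: by end_near. Qed.

End generating_function.

(** * The two evaluations *)

Section evaluation.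
Context {R : realType}.
Implicit Types (l mu : R) (n k : nat).

Lemma gegenbauer_eval l (C : nat -> {poly R}) : is_gegenbauer l C ->
  forall n x, (C n).[x] = (geg l n).[x].
Proof.
move=> hC n x; have [C0 [C1 CS]] := gegenbauer_coef l C hC x.
suff H m : (C m).[x] = (geg l m).[x] /\ (C m.+1).[x] = (geg l m.+1).[x] by have [] := H n.
have g0 : geg l 0 = 1%:P by [].
elim: m => [|m [IH0 IH1]].
  rewrite C0 C1 g0 hornerC; split=> //.
  have := congr1 (fun p : {poly R} => p.[x]) (geg_recl l 0).
  by rewrite g0 /geg_prev /= -(polyC_natr R 1) !hornerE => ->; ring.
split=> //; have n0 : m.+2%:R != 0 :> R by rewrite pnatr_eq0.
apply: (mulfI n0); rewrite CS IH0 IH1.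
have := congr1 (fun p : {poly R} => p.[x]) (geg_rec l m).
by rewrite -(polyC_natr R m.+2) !hornerE => ->.
Qed.

Lemma weighted_norm2_geg l mu (C : nat -> {poly R}) n : - 2^-1 < mu ->
  is_gegenbauer l C ->
  weighted_norm2 mu (C n) = (weight_mass mu * moment mu (geg l n ^+ 2))%:E.
Proof.
move=> hmu hC; rewrite /moment /moment_lin -integral_weight_poly//.
apply: eq_integral => x _; congr (_ * _)%:E.
rewrite (gegenbauer_eval _ _ hC) -horner_exp -[in LHS]even_part_geg_sqr horner_comp.
by rewrite !hornerE.
Qed.

Lemma pochhammer_eq0 n k : (n < k)%N -> pochhammer (- n%:R : R) k = 0.
Proof.
by move=> nk; rewrite /pochhammer (bigD1 (Ordinal nk))//= addNr mul0r.
Qed.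

Lemma limn_series_stationary (u : nat -> R) m :
  (forall k, (m <= k)%N -> u k = 0) -> limn (series u) = \sum_(k < m) u k.
Proof.
move=> u0; apply/cvg_lim => //; apply: cvg_near_cst; near=> k.
have mk : (m <= k)%N by near: k; exact: nbhs_infty_ge.
rewrite /series /= -(big_mkord xpredT) (big_cat_nat (leq0n m) mk)//=.
rewrite [X in _ + X]big1_seq ?addr0// => i /andP[_].
by rewrite mem_index_iota => /andP[mi _]; exact: u0.
Unshelve. all: by end_near. Qed.

(** The coefficients of the square in [1 - x ^ 2], multiplied by the mean values
    of the powers of [1 - x ^ 2], are the terms of the hypergeometric series. *)
Lemma moment_geg_sqr_pFq l mu n : 0 < l -> - 2^-1 < mu ->
  moment mu (geg l n ^+ 2) = (pochhammer (2 * l) n / n`!%:R) ^+ 2 *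
    pFq [:: - n%:R; n%:R + 2 * l; l; mu + 2^-1] [:: 2 * l; l + 2^-1; mu + 1] 1.
Proof.
move=> hl hmu; set W := even_part (geg l n ^+ 2).
have WE : W \Po (1 - 'X^2) = geg l n ^+ 2 by exact: even_part_geg_sqr.
have W0 : W`_0 = (pochhammer (2 * l) n / n`!%:R) ^+ 2.
  have fn0 : n`!%:R != 0 :> R by rewrite pnatr_eq0 -lt0n fact_gt0.
  rewrite -geg_at1 mulfK// -horner_exp -WE horner_comp -horner_coef0.
  by rewrite !hornerE expr1n subrr.
have WC := clausen_coef l n W WE hl.
rewrite /moment -/W (@moment_lin_wide _ _ _ (maxn (size W) n.+1)) ?leq_maxl//.
rewrite /pFq (@limn_series_stationary _ (maxn (size W) n.+1)); last first.
  move=> k; rewrite geq_max => /andP[_ nk].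
  by rewrite big_cons pochhammer_eq0// !mul0r.
rewrite mulr_sumr; apply: eq_bigr => k _.
rewrite WC W0 /weight_ratio !big_cons !big_nil expr1n !mulr1 !invfM.
by ring.
Qed.

Lemma J_sumE l mu n : - 2^-1 < mu -> mu != 0 ->
  J_sum l mu n = weight_mass mu * moment mu (geg l n ^+ 2).
Proof.
move=> hmu mu0; rewrite moment_geg_sqr// /J_sum /weight_mass mulrA; congr (_ * _).
by rewrite invfM; ring.
Qed.

Lemma cvg_bigsum (I : Type) (r : seq I) (F : I -> R -> R) (a : I -> R) (x : R) :
  (forall i, F i m @[m --> x] --> a i) ->
  \sum_(i <- r) F i m @[m --> x] --> \sum_(i <- r) a i.
Proof.
move=> Fa; elim: r => [|i r IHr].
  by under eq_fun do rewrite big_nil; rewrite big_nil; exact: cvg_cst.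
by under eq_fun do rewrite big_cons; rewrite big_cons; exact: cvgD.
Qed.

Lemma cvg_weight_mass_moment0 (P : {poly R}) :
  weight_mass m * moment m P @[m --> (0 : R)] --> weight_mass 0 * moment 0 P.
Proof.
apply: cvgM; first exact: cvg_weight_mass0.
have cp (a : R) k : pochhammer (m + a) k @[m --> (0 : R)] --> pochhammer (0 + a) k.
  elim: k => [|k IHk].
    by under eq_fun do rewrite pochhammer0; rewrite pochhammer0; exact: cvg_cst.
  under eq_fun do rewrite pochhammerS.
  rewrite pochhammerS; apply: (cvgM IHk).
  by apply: cvgD; [apply: cvgD; [exact: cvg_id|exact: cvg_cst]|exact: cvg_cst].
rewrite /moment /moment_lin; apply: cvg_bigsum => k.
apply: cvgMr; apply: (cvgM (cp _ _)); apply: cvgV (cp _ _).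
by rewrite gt_eqF// pochhammer_gt0// add0r.
Qed.

End evaluation.

Theorem theorem5 (R : realType) (lambda mu : R) (C : nat -> {poly R})
    (hmu : - 2^-1 < mu) (hlambda : 0 < lambda)
    (hC : is_gegenbauer lambda C) (n : nat) :
  [/\ weighted_norm2 mu (C n) =
        (Num.sqrt pi * Gamma (mu + 2^-1) / Gamma (mu + 1)
         * (pochhammer (2 * lambda) n / n`!%:R) ^+ 2
         * pFq [:: - n%:R; n%:R + 2 * lambda; lambda; mu + 2^-1]
               [:: 2 * lambda; lambda + 2^-1; mu + 1] 1)%:E,
      mu != 0 -> weighted_norm2 mu (C n) = (J_sum lambda mu n)%:E
    & mu = 0 ->
        (J_sum lambda m n)%:E @[m --> (0 : R)^'] --> weighted_norm2 0 (C n)].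
Proof.
split.
- by rewrite (weighted_norm2_geg lambda)// moment_geg_sqr_pFq// mulrA.
- by move=> mu0; rewrite (weighted_norm2_geg lambda)// J_sumE.
move=> _; rewrite (weighted_norm2_geg lambda) ?oppr_lt0//.
apply: cvg_EFin; first exact: nearW.
(* Near 0 but not at 0, the sum is the integral with the weight of parameter [m]. *)
have cJ := cvg_weight_mass_moment0 (geg lambda n ^+ 2).
apply: cvg_trans (cvg_within_filter (fun m => m != 0) cJ).
apply: near_eq_cvg; near=> m.
have m0 : m != 0 by near: m; exact: nbhs_dnbhs_neq.
rewrite /= J_sumE//; near: m; apply: nbhs_dnbhs.
by apply: lt_nbhsr; rewrite oppr_lt0.
Unshelve. all: by end_near. Qed.
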